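(* Let $k,\ell\ge 3$ be integers such that either $k$ is odd and $\ell$ is even, or $k$ and $\ell$ have the same parity and $k\le\ell$, and let $d\in(0,1)$. There exist $d_1=d_1(k,\ell),d_2=d_2(k,\ell)\in[0,1]$ such that $p(n;C_k,C_\ell,d)=n^{-1}$ if $0<d\le d_1$, $p(n;C_k,C_\ell,d)=n^{-2}$ if $d_1<d\le d_2$, and $p(n;C_k,C_\ell,d)=0$ if $d_2<d$. Moreover: if $k$ and $\ell$ are both even then $d_1=d_2=0$; if $k$ is odd and $\ell$ is even then $d_1=d_2=1/2$; if $k$ is odd and $\ell=3$ then $d_1=1/2$ and $d_2=4/5$; if $k$ is odd and $\ell\ge5$ is odd then $d_1=1/2$ and $d_2=3/4$.
   Context: $C_m$ denotes the cycle of length $m$. A graph $G$ is $(H_1,H_2)$-Ramsey if every red/blue colouring of its edges contains a red copy of $H_1$ or a blue copy of $H_2$. The density of an $n$-vertex graph $G$ is $e(G)/\binom n2$. $G(n,p)$ is the binomial random graph on $[n]$ and $G_n\cup G(n,p)$ the union graph on $[n]$. For $0<d<1$, the perturbed Ramsey threshold $p(n;H_1,H_2,d)$ is a function such that: (i) if $p=\omega(p(n;H_1,H_2,d))$ then for every sequence $(G_n)$ of $n$-vertex graphs of density at least $d$, $G_n\cup G(n,p)$ is $(H_1,H_2)$-Ramsey with high probability; (ii) if $p=o(p(n;H_1,H_2,d))$ then for some such sequence $(G_n)$, with high probability $G_n\cup G(n,p)$ is not $(H_1,H_2)$-Ramsey. If every sufficiently large graph of density at least $d$ is already $(H_1,H_2)$-Ramsey,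 the threshold is defined to be $0$. *)

(* Defs.v *)
From HB Require Import structures.
From mathcomp Require Import all_boot all_order all_algebra.
From mathcomp Require Import reals.
Set Implicit Arguments. Unset Strict Implicit. Unset Printing Implicit Defensive.
Import Order.TTheory GRing.Theory Num.Theory.
Local Open Scope ring_scope.

Definition graph (n : nat) := {set ('I_n * 'I_n)}.

Definition adj {n} (G : graph n) (x y : 'I_n) : bool :=
  (x != y) && (((x, y) \in G) || ((y, x) \in G)).

Definition upairs (n : nat) : {set ('I_n * 'I_n)} := [set e : 'I_n * 'I_n | (e.1 < e.2)%N].

Definition nedges {n} (G : graph n) : nat :=
  #|[set e in upairs n | adj G e.1 e.2]|.

Definition density {R : realType} {n} (G : graph n) : R :=
  (nedges G)%:R / ('C(n, 2))%:R.

(* red/blue colouring of (unordered) pairs: true = red, false = blue *)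
Definition colouring (n : nat) := {ffun ('I_n * 'I_n) -> bool}.

Definition col {n} (c : colouring n) (x y : 'I_n) : bool :=
  if (x < y)%N then c (x, y) else c (y, x).

Definition has_mono_cycle {n} (G : graph n) (c : colouring n) (b : bool)
  (m : nat) : bool :=
  [exists v : {ffun 'I_m -> 'I_n}, injectiveb v &&
     [forall i : 'I_m, adj G (v i) (v (ordS i)) && (col c (v i) (v (ordS i)) == b)]].

Definition cycle_ramsey {n} (G : graph n) (k l : nat) : bool :=
  [forall c : colouring n, has_mono_cycle G c true k || has_mono_cycle G c false l].

Definition gnp_prob {R : realType} (n : nat) (p : R) (P : graph n -> bool) : R :=
  \sum_(S in powerset (upairs n))
     p ^+ #|S| * (1 - p) ^+ (#|upairs n| - #|S|)%N * (P S)%:R.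

Definition union_graph {n} (G S : graph n) : graph n := G :|: S.

Definition tends_to_one {R : realType} (a : nat -> R) : Prop :=
  forall eps : R, 0 < eps -> exists N, forall n, (N <= n)%N -> 1 - eps <= a n.

(* p = o(f) and p = omega(f) for nonnegative f *)
Definition little_o {R : realType} (p f : nat -> R) : Prop :=
  forall eps : R, 0 < eps -> exists N, forall n, (N <= n)%N -> p n <= eps * f n.
Definition little_omega {R : realType} (p f : nat -> R) : Prop :=
  forall C : R, 0 < C -> exists N, forall n, (N <= n)%N -> C * f n <= p n.

Definition is_prob_seq {R : realType} (p : nat -> R) : Prop :=
  forall n, 0 <= p n <= 1.

Definition dense_seq {R : realType} (d : R) (G : forall n, graph n) : Prop :=
  exists N, forall n, (N <= n)%N -> d <= density (G n).

Definition perturbed_threshold {R : realType} (k l : nat) (d : R) (f : nat -> R) : Prop :=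
  (forall p : nat -> R, is_prob_seq p -> little_omega p f ->
     forall G : forall n, graph n, dense_seq d G ->
       tends_to_one (fun n => gnp_prob (p n)
                               (fun S => cycle_ramsey (union_graph (G n) S) k l)))
  /\
  (forall p : nat -> R, is_prob_seq p -> little_o p f ->
     exists G : forall n, graph n, dense_seq d G /\
       tends_to_one (fun n => gnp_prob (p n)
                               (fun S => ~~ cycle_ramsey (union_graph (G n) S) k l))).

Definition threshold_zero {R : realType} (k l : nat) (d : R) : Prop :=
  exists N, forall n, (N <= n)%N -> forall G : graph n, d <= density G ->
    cycle_ramsey G k l.

Definition inv_n {R : realType} (n : nat) : R := (n%:R)^-1.
Definition inv_n2 {R : realType} (n : nat) : R := (n%:R ^+ 2)^-1.

(* Main.v *)
(* Upper bounds.  A graph of density more than 1 - 1/(r-1) has a positive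
   density of r-cliques (Moon-Moser); by pigeonhole a positive density of them
   shows one and the same colour pattern, and convexity turns this into a blow-up
   of that pattern.  A blown-up edge contains all short even cycles, a blown-up
   triangle all short cycles, a blown-up pentagon the odd ones of length >= 5, so
   the deterministic thresholds follow from the 2-colourings of K_2, K_3, K_5, K_6.

   When p >> 1/n^2, a positive density of blown-up triangles in G_n yields, by the
   second moment method, one whose parts carry perfect matchings of random edges.
   Three matching edges, one in each part, span a K_6; making the patterns of
   these K_6 uniform, a monochromatic triangle of K_6 blows up to odd cycles.

   When p >> 1/n, the second moment method yields many disjoint random k- and
   l-cycles whose vertices have a common neighbourhood of linear size in G_n, and
   every set of linear size spans a random edge.  Linearly many common neighbours
   see the cycles in the same colour pattern.  If almost all of it is red, some
   l-cycle is completely red towards them, and each of its edges is blue or closes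
   a red C_k; symmetrically for blue, and a mixed pattern closes a cycle through a
   random edge (or, for l even, a blue even cycle) in the neighbourhood.

   Lower bounds.  Take the complete bipartite graph in red and the random edges in
   blue, respectively a complete 4- or 5-partite graph without random edges. *)
Require Import Defs.
From HB Require Import structures.
From mathcomp Require Import all_boot all_order all_algebra.
From mathcomp Require Import reals.
From mathcomp Require Import zify ring lra.
Set Implicit Arguments. Unset Strict Implicit. Unset Printing Implicit Defensive.
Import Order.TTheory GRing.Theory Num.Theory.
Local Open Scope ring_scope.

(** * The binomial measure *)

Section BinomialMeasure.
Variables (R : realType) (n : nat) (p : R).
Hypothesis p01 : 0 <= p <= 1.
Implicit Types (P Q : graph n -> bool) (A B S : graph n).

Let p_ge0 : 0 <= p. Proof. by case/andP: p01. Qed.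
Let q_ge0 : 0 <= 1 - p. Proof. by case/andP: p01 => _; rewrite subr_ge0. Qed.

Definition gnp_weight S : R :=
  p ^+ #|S| * (1 - p) ^+ (#|upairs n| - #|S|)%N.

Lemma gnp_weight_ge0 S : 0 <= gnp_weight S.
Proof. by rewrite mulr_ge0 ?exprn_ge0. Qed.

Lemma gnp_probE P :
  gnp_prob p P = \sum_(S in powerset (upairs n)) gnp_weight S * (P S)%:R.
Proof. by []. Qed.

Lemma gnp_mono P Q :
  (forall S, S \subset upairs n -> P S -> Q S) -> gnp_prob p P <= gnp_prob p Q.
Proof.
move=> PQ; rewrite !gnp_probE; apply: ler_sum => S; rewrite powersetE => sS.
apply: ler_wpM2l; first exact: gnp_weight_ge0.
by rewrite ler_nat; case: (P S) (PQ S sS) => // ->.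
Qed.

Lemma gnp_ge0 P : 0 <= gnp_prob p P.
Proof.
by rewrite gnp_probE sumr_ge0 // => S _; rewrite mulr_ge0 ?gnp_weight_ge0.
Qed.

Lemma gnp_union P Q :
  gnp_prob p (fun S => P S || Q S) <= gnp_prob p P + gnp_prob p Q.
Proof.
rewrite !gnp_probE -big_split; apply: ler_sum => S _ /=.
rewrite -mulrDr; apply: ler_wpM2l; first exact: gnp_weight_ge0.
by rewrite -natrD ler_nat; case: (P S); case: (Q S).
Qed.

Lemma gnp_exists (T : finType) (P : T -> graph n -> bool) (C : pred T) :
  gnp_prob p (fun S => [exists (x | C x), P x S])
    <= \sum_(x | C x) gnp_prob p (P x).
Proof.
under [leRHS]eq_bigr do rewrite gnp_probE.
rewrite exchange_big gnp_probE; apply: ler_sum => S _ /=.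
rewrite -mulr_sumr; apply: ler_wpM2l; first exact: gnp_weight_ge0.
case: existsP => [[x /andP[Cx Px]]|_]; last by rewrite sumr_ge0.
rewrite (bigD1 x) //= Px lerDl sumr_ge0 //.
Qed.

(** Pairs are present independently: the product over all pairs of the weight of being present plus
    the weight of being absent expands into the sum over all [S]. Weights that the event forbids are
    set to zero. *)
Lemma gnp_sub_disjoint A B : A \subset upairs n -> B \subset upairs n ->
  [disjoint A & B] ->
  gnp_prob p (fun S => (A \subset S) && [disjoint B & S])
    = p ^+ #|A| * (1 - p) ^+ #|B|.
Proof.
move=> sA sB dAB.
(* Outside [upairs n] the two weights are 0 and 1, so that only subsets of [upairs n] survive in the
   expansion. *)
pose F e := if e \in upairs n then p * (e \notin B)%:R else 0.
pose G e := if e \in upairs n then (1 - p) * (e \notin A)%:R else 1.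
have prodFG : \prod_e (F e + G e) = p ^+ #|A| * (1 - p) ^+ #|B|.
  rewrite -!prodr_const (big_mkcond (mem A)) (big_mkcond (mem B)) -big_split /=.
  apply: eq_bigr => e _; rewrite /F /G.
  have [eA|eA] := boolP (e \in A).
    by rewrite (subsetP sA) // (disjointFr dAB eA) mulr1 mulr0 addr0.
  have [eB|eB] := boolP (e \in B); last by case: ifP => _ /=; rewrite ?mulr1 ?add0r // addrC subrK.
  by rewrite (subsetP sB) //= mulr0 add0r mulr1 mul1r.
rewrite -prodFG bigA_distr gnp_probE big_mkcond; apply: eq_bigr => S _ /=.
rewrite powersetE.
have prod0 e : (if e \in S then F e else G e) = 0 ->
    \prod_i (if i \in S then F i else G i) = 0.
  by move=> E0; rewrite (bigD1 e) //= E0 mul0r.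
case: ifP => [sS|/negbT /subsetPn[e eS eU]]; last first.
  by rewrite (prod0 e) // eS /F (negPf eU).
have [sAS|/subsetPn[e eA eS]] := boolP (A \subset S); last first.
  by rewrite mulr0 (prod0 e) // (negPf eS) /G eA (subsetP sA) //= mulr0.
have [dBS|/pred0Pn[e /andP[/= eB eS]]] := boolP [disjoint B & S]; last first.
  by rewrite mulr0 (prod0 e) // eS /F eB (subsetP sB) //= mulr0.
rewrite mulr1 /gnp_weight -[#|upairs n|](cardsID S) (setIidPr sS) addKn.
rewrite -!prodr_const (big_mkcond (mem S)) (big_mkcond (mem (_ :\: _))).
rewrite -big_split /=; apply: eq_bigr => e _; rewrite inE /F /G.
have [eS|eS] /= := boolP (e \in S).
  by rewrite (subsetP sS) // (disjointFl dBS eS) /=.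
case: ifP => _; last by rewrite mul1r.
by rewrite (contraNN (subsetP sAS e) eS) mulr1 mul1r.
Qed.

Lemma gnp_sub A : A \subset upairs n ->
  gnp_prob p (fun S => A \subset S) = p ^+ #|A|.
Proof.
move=> sA; have := gnp_sub_disjoint sA (sub0set _).
rewrite -setI_eq0 setI0 eqxx cards0 expr0 mulr1 => <- //.
apply: eq_bigr => S _; congr (_ * (nat_of_bool _)%:R).
by rewrite -setI_eq0 set0I eqxx andbT.
Qed.

Lemma gnp_disjoint B : B \subset upairs n ->
  gnp_prob p (fun S => [disjoint B & S]) = (1 - p) ^+ #|B|.
Proof.
move=> sB; have := gnp_sub_disjoint (sub0set _) sB.
rewrite -setI_eq0 set0I eqxx cards0 expr0 mul1r => <- //.
by apply: eq_bigr => S _; rewrite sub0set.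
Qed.

Lemma gnp_true : gnp_prob p (fun _ : graph n => true) = 1.
Proof.
have := gnp_sub (sub0set _); rewrite cards0 expr0 => <-.
by apply: eq_bigr => S _; rewrite sub0set.
Qed.

Lemma sum_gnp_weight : \sum_(S in powerset (upairs n)) gnp_weight S = 1.
Proof. by rewrite -gnp_true; apply: eq_bigr => S _; rewrite mulr1. Qed.

Lemma gnp_compl P : gnp_prob p P = 1 - gnp_prob p (fun S => ~~ P S).
Proof.
apply/eqP; rewrite eq_sym subr_eq -gnp_true !gnp_probE -big_split /=; apply/eqP.
apply: eq_bigr => S _; rewrite -mulrDr -natrD; congr (_ * _%:R).
by case: (P S).
Qed.

Lemma gnp_prob_lb P eps :
  gnp_prob p (fun S => ~~ P S) <= eps -> 1 - eps <= gnp_prob p P.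
Proof. by move=> le_eps; rewrite (gnp_compl P) lerB. Qed.

(* Chebyshev's inequality for the number of [t \in F] with [E t \subset S]. *)
Lemma second_moment (T : finType) (F : {set T}) (E : T -> graph n) (m : nat) :
    0 < p ->
    {in F, forall t, E t \subset upairs n} -> {in F, forall t, #|E t| = m} ->
  gnp_prob p (fun S => [forall (t | t \in F), ~~ (E t \subset S)]) * #|F|%:R ^+ 2
    <= \sum_(t in F) \sum_(u in F | E t :&: E u != set0) p ^- #|E t :&: E u|.
Proof.
move=> p0 sE cE.
pose X S : R := \sum_(t in F) (E t \subset S)%:R.
pose ex (f : graph n -> R) := \sum_(S in powerset (upairs n)) gnp_weight S * f S.
have exX : ex X = #|F|%:R * p ^+ m.
  rewrite /ex /X; under eq_bigr do rewrite mulr_sumr.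
  rewrite exchange_big /= -sum1_card natr_sum mulr_suml.
  by apply: eq_bigr => t tF; rewrite mul1r -(cE _ tF) -gnp_sub ?sE.
have exX2 : ex (fun S => X S ^+ 2)
    = \sum_(t in F) \sum_(u in F) p ^+ (m + m - #|E t :&: E u|)%N.
  rewrite /ex /X.
  under eq_bigr => S _ do rewrite expr2 mulr_suml mulr_sumr.
  rewrite exchange_big /=; apply: eq_bigr => t tF.
  under eq_bigr => S _ do rewrite !mulr_sumr.
  rewrite exchange_big /=; apply: eq_bigr => u uF.
  rewrite -{1}(cE _ tF) -(cE _ uF) -cardsU -gnp_sub ?subUset ?sE //.
  apply: eq_bigr => S _; rewrite subUset.
  rewrite -/(gnp_weight S) -natrM mulnb; by case: (_ && _).
set P0 := gnp_prob _ _.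
(* Where no [E t] is contained in [S], the squared deviation of [X] from its mean is the squared
   mean; elsewhere it is nonnegative. *)
have cheb : P0 * (#|F|%:R * p ^+ m) ^+ 2
    <= ex (fun S => X S ^+ 2) - (#|F|%:R * p ^+ m) ^+ 2.
  have -> : ex (fun S => X S ^+ 2) - (#|F|%:R * p ^+ m) ^+ 2
      = ex (fun S => (X S - #|F|%:R * p ^+ m) ^+ 2).
    set c := _ * p ^+ m.
    have split S : gnp_weight S * (X S - c) ^+ 2 = gnp_weight S * X S ^+ 2
        + (- 2 * c) * (gnp_weight S * X S) + c ^+ 2 * gnp_weight S.
      by ring.
    rewrite /ex (eq_bigr _ (fun S _ => split S)) !big_split /= -!mulr_sumr.
    by rewrite -/(ex X) exX sum_gnp_weight /c; ring.
  rewrite /P0 gnp_probE mulr_suml; apply: ler_sum => S _.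
  rewrite -mulrA; apply: ler_wpM2l; first exact: gnp_weight_ge0.
  case: forallP => [noE|_]; last by rewrite mul0r sqr_ge0.
  rewrite mul1r /X big1 ?sub0r ?sqrrN // => t tF.
  by have /implyP/(_ tF)/negPf-> := noE t.
rewrite -(ler_pM2r (_ : 0 < p ^+ (m + m))) ?exprn_gt0 //.
rewrite -mulrA exprD -expr2 -exprMn (le_trans cheb) // exX2 lerBlDr.
(* Pairs with disjoint edge sets cancel against the squared mean; for overlapping pairs the negative
   term is dropped. *)
rewrite (_ : (_ * p ^+ m) ^+ 2 = \sum_(t in F) \sum_(u in F) p ^+ (m + m)).
  rewrite mulr_suml -big_split /=; apply: ler_sum => t tF.
  rewrite big_mkcondr mulr_suml -big_split /=; apply: ler_sum => u uF.
  have [->|] := eqVneq (E t :&: E u) set0.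
    by rewrite cards0 subn0 mul0r add0r.
  move=> _; rewrite -[leLHS]addr0 lerD ?exprn_ge0 //.
  have jm : (#|E t :&: E u| <= m)%N.
    by rewrite -(cE _ tF) subset_leq_card ?subsetIl.
  rewrite mulrC -exprM muln2 -addnn expfB_cond // gt_eqF //.
  by apply: leq_trans jm (leq_addr _ _).
under eq_bigr do rewrite sumr_const -mulr_natl.
by rewrite sumr_const -mulr_natl exprD; ring.
Qed.
End BinomialMeasure.

(** * Embedding a fixed graph *)

Definition upair {n} (x y : 'I_n) : 'I_n * 'I_n :=
  if (x < y)%N then (x, y) else (y, x).

Lemma upair_in n (x y : 'I_n) : x != y -> upair x y \in upairs n.
Proof.
rewrite -val_eqE inE /upair => xy /=.
by case: ifP => //= /negbT; rewrite -leqNgt ltn_neqAle eq_sym xy.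
Qed.

Lemma upair_eq n (x y u v : 'I_n) : upair x y = upair u v ->
  (x, y) = (u, v) \/ (x, y) = (v, u).
Proof.
by rewrite /upair; case: ifP => _; case: ifP => _ [-> ->]; [left|right|right|left].
Qed.

Lemma adjC n (G : graph n) x y : adj G x y = adj G y x.
Proof. by rewrite /adj eq_sym orbC. Qed.

Lemma adj_neq n (G : graph n) x y : adj G x y -> x != y.
Proof. by case/andP. Qed.

Lemma adj_upair n (S : graph n) x y : S \subset upairs n ->
  adj S x y = (x != y) && (upair x y \in S).
Proof.
move=> sS; rewrite /adj; have [//|xy] /= := eqVneq x y.
have nS (u v : 'I_n) : (v <= u)%N -> ((u, v) \in S) = false.
  by move=> vu; apply: contraTF vu => /(subsetP sS); rewrite inE -ltnNge.
rewrite /upair; case: ltnP => lt_xy; last by rewrite nS.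
by rewrite (nS y x (ltnW lt_xy)) orbF.
Qed.

Section Embedding.
Variables (D J : finType) (e : J -> D * D).
Hypothesis loopless : forall j, (e j).1 != (e j).2.
Hypothesis simple : forall i j,
  e i = e j \/ e i = ((e j).2, (e j).1) -> i = j.

Definition edge_image n (f : {ffun D -> 'I_n}) : graph n :=
  [set upair (f (e j).1) (f (e j).2) | j : J].

Variable n : nat.
Implicit Types (f g : {ffun D -> 'I_n}) (S : graph n).

Lemma upair_image_inj f : injective f ->
  injective (fun j => upair (f (e j).1) (f (e j).2)).
Proof.
move=> fI i j /upair_eq H; apply: simple.
rewrite (surjective_pairing (e i)).
by case: H => [[/fI-> /fI->]|[/fI-> /fI->]]; [left; case: (e j)|right].
Qed.

Lemma card_edge_image f : injective f -> #|edge_image f| = #|J|.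
Proof. by move=> fI; rewrite card_imset //; apply: upair_image_inj. Qed.

Lemma edge_image_sub f : injective f -> edge_image f \subset upairs n.
Proof.
move=> fI; apply/subsetP => _ /imsetP[j _ ->].
by rewrite upair_in // (inj_eq fI).
Qed.

Lemma edge_image_adj f S j : injective f -> S \subset upairs n ->
  edge_image f \subset S -> adj S (f (e j).1) (f (e j).2).
Proof.
move=> fI sS fS; rewrite adj_upair // (inj_eq fI) loopless.
by rewrite (subsetP fS) //; apply: imset_f.
Qed.

Variables (own : D -> J) (b : nat).
Hypothesis own_end : forall s, s = (e (own s)).1 \/ s = (e (own s)).2.
Hypothesis card_own : forall j, #|[set s | own s == j]| = b.

(** A common edge is the image under [g] of an edge whose two ends both land in the image of [f].
    The [b] slots it owns are among these ends, and different edges own different slots. *)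
Lemma edge_image_overlap f g :
  (#|edge_image f :&: edge_image g| * b <= #|[set s | g s \in codom f]|)%N.
Proof.
pose I := [set j | upair (g (e j).1) (g (e j).2) \in edge_image f].
have card_I : (#|edge_image f :&: edge_image g| <= #|I|)%N.
  apply: leq_trans (leq_imset_card (fun j => upair (g (e j).1) (g (e j).2)) (mem I)).
  apply: subset_leq_card; apply/subsetP => x /setIP[xf /imsetP[j _ xE]].
  by apply/imsetP; exists j => //; rewrite inE -xE.
apply: leq_trans (_ : #|I| * b <= _)%N; first by rewrite leq_mul2r card_I orbT.
have -> : (#|I| * b = #|[set s | own s \in I]|)%N.
  rewrite -[RHS]sum1_card (partition_big own (mem I)) /=; last by move=> s; rewrite inE.
  rewrite -sum_nat_const; apply: eq_bigr => j jI.
  rewrite -(card_own j) -sum1_card; apply: eq_bigl => s.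
  by rewrite !inE; case: eqP => [->|]; rewrite ?andbF //; move: jI; rewrite inE => ->.
apply: subset_leq_card; apply/subsetP => s; rewrite !inE => /imsetP[j _].
by case/upair_eq=> -[E1 E2]; case: (own_end s) => ->;
  rewrite ?E1 ?E2 codom_f.
Qed.

(* [own] gives every edge [b] slots of its own, so two copies sharing [j] edges
   share at least [j * b] slots, and a weight [q = p^(-1/b)] on each shared slot
   dominates [p^-j]; the weighted sum over all second copies is a product. *)
Lemma second_moment_embedding (R : realType) (p q : R) (F : {set {ffun D -> 'I_n}}) :
    0 < p <= 1 -> (0 < b)%N -> 1 <= q -> q ^+ b = p^-1 ->
    {in F, forall f, injective f} ->
  gnp_prob p (fun S => [forall (f | f \in F), ~~ (edge_image f \subset S)])
      * #|F|%:R
    <= #|D|%:R ^+ 2 * q * (n%:R + #|D|%:R * q) ^+ #|D|.-1.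
Proof.
move=> /andP[p0 p1] b0 q1 qb injF.
have p01 : 0 <= p <= 1 by rewrite ltW.
have q0 : 0 <= q by apply: le_trans q1.
set P0 := gnp_prob _ _; set B := _ * q * _.
have [->|F0] := eqVneq #|F| 0%N.
  by rewrite mulr0 !mulr_ge0 ?exprn_ge0 ?addr_ge0 ?mulr_ge0.
have Fgt0 : 0 < #|F|%:R :> R by rewrite ltr0n lt0n.
rewrite -(ler_pM2r Fgt0) -mulrA -expr2.
apply: le_trans (second_moment p01 (m := #|J|) p0 _ _) _.
- by move=> f fF; apply: edge_image_sub (injF _ fF).
- by move=> f fF; apply: card_edge_image (injF _ fF).
rewrite [leRHS]mulrC mulr_natl -sumr_const; apply: ler_sum => f fF.
have fI := injF _ fF.
pose w (v : 'I_n) : R := if v \in codom f then q else 1.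
pose hit (v : 'I_n) : R := if v \in codom f then q else 0.
have w_ge0 v : 0 <= w v by rewrite /w; case: ifP.
have hit_ge0 v : 0 <= hit v by rewrite /hit; case: ifP.
have card_codom_f : #|codom f| = #|D| by rewrite card_codom.
have sum_hit : \sum_v hit v = #|D|%:R * q.
  by rewrite -big_mkcond sumr_const card_codom_f mulr_natl.
have sum_w : \sum_v w v <= n%:R + #|D|%:R * q.
  rewrite -sum_hit -[n in n%:R]card_ord -sum1_card natr_sum -big_split /=.
  by apply: ler_sum => v _; rewrite /w /hit; case: ifP => _; rewrite ?lerDr ?addr0.
(* Copies sharing an edge share a slot [s]. Forcing [g s] into the image of [f] replaces one factor
   [n + |D| q] by [|D| q], which is the gain over counting all maps. *)
apply: le_trans (_ : \sum_s \sum_(g : {ffun D -> 'I_n})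
    \prod_d (if d == s then hit (g d) else w (g d)) <= _).
  rewrite exchange_big /= (big_mkcond (fun u => (u \in F) && _)) /=.
  apply: ler_sum => g _.
  have term_ge0 s : 0 <= \prod_d (if d == s then hit (g d) else w (g d)).
    by apply: prodr_ge0 => d _; case: ifP.
  case: ifP => [/andP[gF]|_]; last by rewrite sumr_ge0.
  rewrite -card_gt0 => j0; have := edge_image_overlap f g; set j := #|_|.
  set a := #|_| => ja.
  have [s] : exists s, s \in [set s | g s \in codom f].
    by apply/card_gt0P; apply: leq_trans ja; rewrite muln_gt0 j0.
  rewrite inE => sf; rewrite (bigD1 s) //= -[leLHS]addr0.
  apply: lerD; last by rewrite sumr_ge0.
  apply: le_trans (_ : q ^+ a <= _).
    by rewrite -exprVn -qb -exprM mulnC ler_weXn2l.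
  rewrite /a -prodr_const big_mkcond /=; apply: ler_prod => d _.
  rewrite inE; case: ifP => gd; rewrite ?q0 ?ler01 /=.
    by case: eqP => [_|_]; rewrite /hit /w gd.
  case: eqP => [ds|_]; last by rewrite /w gd.
  by rewrite ds sf in gd.
rewrite (_ : B = \sum_(s : D) (#|D|%:R * q * (n%:R + #|D|%:R * q) ^+ #|D|.-1));
  last by rewrite sumr_const /B expr2 -[RHS]mulr_natl !mulrA.
apply: ler_sum => s _.
rewrite -(bigA_distr_bigA (fun d v => if d == s then hit v else w v)).
rewrite (bigD1 s) //= eqxx sum_hit.
apply: ler_wpM2l; first by rewrite mulr_ge0.
rewrite -(cardC1 s) -prodr_const; apply: ler_prod => d ds.
by rewrite (negPf ds) sum_w sumr_ge0.
Qed.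

End Embedding.

(** The second moment bound is of order [q n^(|D|-1)], against at least [c n^|D|] copies, so failure
    has probability of order [q / n]. Since [q] is the [b]-th root of [1/p], the case [b = 1]
    reaches down to [p] of order [1/n] and the case [b = 2] to order [1/n^2]. *)
Lemma embedding_whp (R : realType) (D J : finType) (e : J -> D * D)
    (own : D -> J) (b : nat) (c eps : R) :
    (forall j, (e j).1 != (e j).2) ->
    (forall i j, e i = e j \/ e i = ((e j).2, (e j).1) -> i = j) ->
    (forall s, s = (e (own s)).1 \/ s = (e (own s)).2) ->
    (forall j, #|[set s | own s == j]| = b) -> (0 < b)%N -> 0 < c -> 0 < eps ->
  exists2 kappa : R, 0 < kappa & forall (n : nat) (p q : R)
      (F : {set {ffun D -> 'I_n}}),
    (0 < n)%N -> 0 < p <= 1 -> 1 <= q -> q ^+ b = p^-1 -> q <= kappa * n%:R ->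
    {in F, forall f : {ffun D -> 'I_n}, injective f} -> c * n%:R ^+ #|D| <= #|F|%:R ->
    gnp_prob p (fun S => [forall (f | f \in F), ~~ (edge_image e f \subset S)])
      <= eps.
Proof.
move=> loopless simple own_end card_own b0 c0 eps0.
set T := #|D|.
(* [K - 1] is the constant of the second moment bound once [q <= n], which the first entry of the
   minimum below ensures; adding 1 makes [K] positive in all cases. *)
pose K : R := T%:R ^+ 2 * (1 + T%:R) ^+ T.-1 + 1.
have K0 : 0 < K by rewrite ltr_wpDl ?mulr_ge0 ?exprn_ge0 ?addr_ge0.
exists (Num.min 1 (eps * c / K)).
  by rewrite lt_min ltr01 divr_gt0 ?mulr_gt0.
move=> n p q F n0 p01 q1 qb qn injF cF.
set P0 := gnp_prob _ _.
have n0R : 0 < n%:R :> R by rewrite ltr0n.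
have P0ge0 : 0 <= P0.
  by apply: gnp_ge0; case/andP: p01 => /ltW-> ->.
have nT0 : 0 < c * n%:R ^+ T by rewrite mulr_gt0 ?exprn_gt0.
rewrite -(ler_pM2r nT0) (le_trans (ler_wpM2l P0ge0 cF)) //.
apply: le_trans (second_moment_embedding loopless simple own_end card_own p01
  b0 q1 qb injF) _; rewrite -/T.
have q0 : 0 <= q by apply: le_trans q1.
have qn1 : q <= n%:R.
  by apply: le_trans qn _; rewrite -{2}[n%:R]mul1r ler_pM2r // ge_min lexx.
have qn2 : q <= eps * c / K * n%:R.
  by apply: le_trans qn _; rewrite ler_pM2r // ge_min lexx orbT.
have [T0|T0] := posnP T.
  by rewrite T0 expr0n !mul0r !mulr_ge0 ?ltW // ltr0n.
have le_nq : (n%:R + T%:R * q) ^+ T.-1 <= (1 + T%:R) ^+ T.-1 * n%:R ^+ T.-1.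
  rewrite -exprMn; apply: lerXn2r; rewrite ?nnegrE ?addr_ge0 ?mulr_ge0 ?addr_ge0 //.
  by rewrite mulrDl mul1r lerD2l ler_wpM2l.
apply: le_trans (_ : T%:R ^+ 2 * q * ((1 + T%:R) ^+ T.-1 * n%:R ^+ T.-1) <= _).
  by apply: ler_wpM2l; rewrite // mulr_ge0 ?exprn_ge0.
rewrite (_ : _ * _ = (K - 1) * n%:R ^+ T.-1 * q); last by rewrite /K; ring.
apply: le_trans (_ : K * n%:R ^+ T.-1 * (eps * c / K * n%:R) <= _).
  apply: ler_pM => //; first by rewrite addrK !mulr_ge0 ?exprn_ge0 ?addr_ge0.
  by rewrite ler_wpM2r ?exprn_ge0 // lerBlDr lerDl.
rewrite -{2}(prednK T0) exprS le_eqVlt; apply/orP; left; apply/eqP; field.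
by rewrite gt_eqF.
Qed.

(** * Random edges inside every set of linear size *)

Lemma bernoulli_ineq (R : realType) (x : R) (m : nat) :
  0 <= x -> 1 + m%:R * x <= (1 + x) ^+ m.
Proof.
move=> x0; elim: m => [|m IH]; first by rewrite mul0r addr0.
rewrite exprS; apply: le_trans (ler_wpM2l _ IH); last by rewrite addr_ge0.
have : 0 <= m%:R * x ^+ 2 by rewrite mulr_ge0 ?sqr_ge0.
by rewrite -natr1; lra.
Qed.

(** This plays the part of the exponential bound on [(1 - p)^m]. It follows from Bernoulli's
    inequality and [(1 - p)(1 + p) <= 1]. *)
Lemma one_sub_expr_le (R : realType) (p : R) (m : nat) :
  0 <= p <= 1 -> (1 - p) ^+ m * (1 + m%:R * p) <= 1.
Proof.
case/andP=> p0 p1; have q0 : 0 <= 1 - p by rewrite subr_ge0.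
apply: le_trans (ler_wpM2l _ (bernoulli_ineq m p0)) _; first exact: exprn_ge0.
by rewrite -exprMn; apply: exprn_ile1; nra.
Qed.

Lemma card_sym_rel n (r : rel 'I_n) : symmetric r -> irreflexive r ->
  #|[set e | r e.1 e.2]| = (#|[set e in upairs n | r e.1 e.2]|).*2.
Proof.
move=> symr irr; set A := [set e in _ | _].
pose sw (e : 'I_n * 'I_n) := (e.2, e.1).
have swK : involutive sw by case.
have -> : [set e | r e.1 e.2] = A :|: sw @: A.
  apply/setP => -[x y]; rewrite !inE -[(x, y)]/(sw (y, x)).
  rewrite mem_imset; last exact: inv_inj.
  rewrite !inE /= [r y x]symr -andb_orl; case: ltngtP => //= /val_inj ->.
  by rewrite irr.
rewrite cardsU card_imset; last exact: inv_inj.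
rewrite (_ : A :&: _ = set0) ?cards0 ?subn0 ?addnn //.
apply/setP => -[x y]; rewrite !inE -[(x, y)]/(sw (y, x)).
rewrite mem_imset; last exact: inv_inj.
by rewrite !inE /=; case: ltngtP; rewrite ?andbF.
Qed.

Definition spans_edge {n} (S : graph n) (X : {set 'I_n}) : bool :=
  [exists x, exists y, [&& x \in X, y \in X & adj S x y]].

(* The bound says that [X] contains at least [n * (n %/ q)] pairs. *)
Definition no_large_independent (q n : nat) (S : graph n) : bool :=
  [forall X : {set 'I_n},
    (2 * (n * (n %/ q)) <= #|X| * #|X|.-1)%N ==> spans_edge S X].

Lemma card_pairs_in n (X : {set 'I_n}) :
  (#|X| * #|X|.-1 = 2 * #|[set e in upairs n | (e.1 \in X) && (e.2 \in X)]|)%N.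
Proof.
pose r : rel 'I_n := fun x y => [&& x != y, x \in X & y \in X].
have symr : symmetric r by move=> x y; rewrite /r eq_sym [X in _ && X]andbC.
have irr : irreflexive r by move=> x; rewrite /r eqxx.
transitivity #|[set e | r e.1 e.2]|; last first.
  rewrite (card_sym_rel symr irr) -mul2n; congr (2 * _)%N.
  apply: eq_card => -[x y]; rewrite !inE /r /=.
  by case: ltnP => //= xy; rewrite -val_eqE neq_ltn xy.
pose diag := [set (x, x) | x in X].
have -> : [set e | r e.1 e.2] = setX X X :\: diag.
  apply/setP => -[x y]; rewrite !inE /r /=.
  have [xX|_] /= := boolP (x \in X); last by rewrite !andbF.
  congr (~~ _ && _).
  by apply/eqP/imsetP => [<-|[z _ [-> ->]] //]; exists x.
have sdiag : diag \subset setX X X.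
  by apply/subsetP => _ /imsetP[x xX ->]; rewrite inE xX.
rewrite cardsD (setIidPr sdiag) cardsX card_imset => [|x y [] //].
by case: #|X| => // m; rewrite mulnS addKn mulnC.
Qed.

(** Union bound over all [2^n] vertex sets; a set in question has at least [n * (n %/ q)] pairs, all
    of which must be missing. *)
Lemma gnp_no_large_independent (R : realType) (p : R) (q n : nat) :
  0 <= p <= 1 ->
  gnp_prob p (fun S => ~~ @no_large_independent q n S)
    <= 2 ^+ n * (1 - p) ^+ (n * (n %/ q)).
Proof.
move=> p01; case/andP: (p01) => p0 p1.
pose inX (X : {set 'I_n}) := [set e in upairs n | (e.1 \in X) && (e.2 \in X)].
have sinX X : inX X \subset upairs n by apply/subsetP => x; rewrite inE => /andP[].
pose large (X : {set 'I_n}) := (2 * (n * (n %/ q)) <= #|X| * #|X|.-1)%N.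
apply: le_trans (_ : gnp_prob p (fun S => [exists (X | large X), [disjoint inX X & S]]) <= _).
  apply: gnp_mono => // S sS; rewrite negb_forall => /existsP[X].
  rewrite negb_imply => /andP[lX nS]; apply/existsP; exists X.
  rewrite /large lX /=; apply: contraR nS => /pred0Pn[[x y] /andP[/= xyX xyS]].
  apply/existsP; exists x; apply/existsP; exists y.
  move: xyX; rewrite !inE /= => /and3P[xy -> ->] /=.
  by rewrite /adj xyS andbT -val_eqE neq_ltn xy.
apply: le_trans (gnp_exists p01 _ _) _.
apply: le_trans (_ : \sum_(X : {set 'I_n}) (1 - p) ^+ (n * (n %/ q)) <= _).
  rewrite big_mkcond; apply: ler_sum => X _; case: ifP => [lX|_]; last first.
    by rewrite exprn_ge0 // subr_ge0.
  rewrite gnp_disjoint //; apply: ler_wiXn2l; [by rewrite subr_ge0|lra|].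
  by move: lX; rewrite /large card_pairs_in leq_pmul2l.
by rewrite sumr_const -cardsT -powersetT card_powerset cardsT card_ord -[leLHS]mulr_natl natrX.
Qed.

(** The union bound is the [n]-th power of [2 (1 - p)^y] with [y = n %/ q]. It suffices to push this
    base below [min(1, eps)], for which [p y], and hence [p n], need only exceed a constant. *)
Lemma no_large_independent_whp (R : realType) (q : nat) (eps : R) :
    (0 < q)%N -> 0 < eps ->
  exists2 C : R, 0 < C & forall (n : nat) (p : R),
    (q <= n)%N -> 0 <= p <= 1 -> C <= p * n%:R ->
    gnp_prob p (fun S => ~~ @no_large_independent q n S) <= eps.
Proof.
move=> q0 eps0; pose d := Num.min 1 eps.
have d0 : 0 < d by rewrite lt_min ltr01.
have q0R : 0 < q%:R :> R by rewrite ltr0n.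
exists (4 * q%:R / d); first by rewrite divr_gt0 ?mulr_gt0.
move=> n p qn p01 Cpn; case/andP: (p01) => p0 p1.
have n0 : (0 < n)%N by apply: leq_trans qn.
apply: le_trans (gnp_no_large_independent _ _ p01) _.
set y := (n %/ q)%N.
(* As [q <= n], rounding down loses at most a factor 2. *)
have yn : n%:R <= 2 * q%:R * y%:R :> R.
  rewrite -natrM -natrM ler_nat.
  have := divn_eq n q; have := ltn_pmod n q0; have := divn_gt0 n q0.
  by rewrite qn -/y; nia.
rewrite mulnC exprM -exprMn.
have r0 : 0 <= 2 * (1 - p) ^+ y by rewrite mulr_ge0 ?exprn_ge0 ?subr_ge0.
have rd : 2 * (1 - p) ^+ y <= d.
  have := one_sub_expr_le y p01.
  set z := (1 - p) ^+ y => zle.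
  have z0 : 0 <= z by rewrite exprn_ge0 ?subr_ge0.
  have ypC : 2 / d <= y%:R * p.
    rewrite -(ler_pM2l (_ : 0 < 2 * q%:R)) ?mulr_gt0 //.
    apply: le_trans (_ : p * n%:R <= _); first by apply: le_trans Cpn; lra.
    by apply: le_trans (ler_wpM2l p0 yn) _; lra.
  rewrite ler_pdivrMr // in ypC.
  by nra.
have d1 : d <= 1 by rewrite ge_min lexx.
apply: le_trans (_ : d <= _); last by rewrite ge_min lexx orbT.
apply: le_trans (rd); rewrite -[leRHS]expr1; by apply: ler_wiXn2l => //; apply: le_trans rd d1.
Qed.

(** * Blow-ups of positive density *)

(** Convexity of the power on nonnegative reals: its graph lies above the tangent at [d]. The
    induction step leaves a multiple of [(a - d)^2]. *)
Lemma tangent_power (R : realFieldType) (a d : R) (m : nat) : 0 <= a -> 0 <= d ->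
  d ^+ m + m%:R * d ^+ m.-1 * (a - d) <= a ^+ m.
Proof.
move=> a0 d0; elim: m => [|m IH]; first by rewrite !mul0r addr0.
rewrite [a ^+ _]exprS; apply: le_trans (ler_wpM2l a0 IH).
case: m {IH} => [|m] /=; first by rewrite !expr1 !expr0; lra.
rewrite -subr_ge0 !exprS.
rewrite (_ : _ - _ = m.+1%:R * d ^+ m * (a - d) ^+ 2).
  by apply: mulr_ge0 (sqr_ge0 _); rewrite mulr_ge0 ?exprn_ge0.
rewrite -[m.+2%:R]natr1; ring.
Qed.

(** Summing the tangents at [d], the linear terms add up to a nonnegative number because the mean of
    [a] is at least [d]. *)
Lemma power_mean (R : realFieldType) (T : finType) (a : T -> R) (d : R) (m : nat) :
    0 <= d -> (forall t, 0 <= a t) -> d * #|T|%:R <= \sum_t a t ->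
  d ^+ m * #|T|%:R <= \sum_t a t ^+ m.
Proof.
move=> d0 a0 le_d.
apply: le_trans (ler_sum _ (fun t _ => tangent_power m (a0 t) d0)).
rewrite big_split -mulr_sumr sumrB /= !sumr_const -[d ^+ m *+ _]mulr_natr.
rewrite lerDl mulr_ge0 ?mulr_ge0 ?exprn_ge0 // subr_ge0 -[d *+ _]mulr_natr.
by [].
Qed.

Lemma card_set_pred (R : pzSemiRingType) (T : finType) (P : pred T) :
  #|[set t | P t]|%:R = \sum_t (P t)%:R :> R.
Proof.
rewrite -sum1_card natr_sum big_mkcond; apply: eq_bigr => t _.
by rewrite inE; case: (P t).
Qed.

(** Exchanging a field of [a] with [b] is an involution of [A * B]. In probabilistic terms,
    replacing one coordinate of a uniform point by a fresh uniform value keeps the point uniform. *)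
Lemma sum_resample (R : realFieldType) (A B : finType) (get : A -> B)
    (set : A -> B -> A) (u : A -> R) :
    (forall a b, get (set a b) = b) -> (forall a b, set (set a b) (get a) = a) ->
  \sum_a \sum_b u (set a b) = #|B|%:R * \sum_a u a.
Proof.
move=> getK setK; rewrite pair_bigA /=.
pose h (ab : A * B) := (set ab.1 ab.2, get ab.1).
have hK : involutive h by case=> a b; rewrite /h /= getK setK.
rewrite (reindex_inj (inv_inj hK)) /=.
under eq_bigr => ab _ do rewrite setK.
rewrite -(pair_bigA _ (fun a (b : B) => u a)) /=.
by under eq_bigr do rewrite sumr_const; rewrite sumrMnl mulr_natl.
Qed.

Section Box.
Variables (R : realFieldType) (I K V : finType) (k0 : K).
Variables (h : {ffun I -> V} -> bool).
Hypothesis V0 : (0 < #|V|)%N.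

Definition transversal (F : {ffun I * K -> V}) (phi : {ffun I -> K}) : {ffun I -> V} :=
  [ffun i => F (i, phi i)].

Let X := {ffun K -> V}.
Let FF := {ffun I * K -> V}.

Let setcol (i : I) (F : FF) (x : X) : FF :=
  [ffun ik => if ik.1 == i then x ik.2 else F ik].
Let getcol (i : I) (F : FF) : X := [ffun k => F (i, k)].

(* Only the coordinates in [A] have been blown up: on the others, transversals
   use the copy [k0]. *)
Let hA (A : {set I}) (F : FF) : bool :=
  [forall phi : {ffun I -> K},
    [forall i, (i \notin A) ==> (phi i == k0)] ==> h (transversal F phi)].

Let g A i F v := hA A (setcol i F [ffun=> v]).

Let getsetcol i F (x : X) : getcol i (setcol i F x) = x.
Proof. by apply/ffunP => k; rewrite !ffunE eqxx. Qed.

Let setgetcol i F (x : X) : setcol i (setcol i F x) (getcol i F) = F.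
Proof. by apply/ffunP => -[j k]; rewrite !ffunE /=; case: eqP => [->|]. Qed.

Let hA_base (A : {set I}) i F (x : X) : i \notin A -> hA A (setcol i F x) = g A i F (x k0).
Proof.
move=> iA; apply: eq_forallb => phi.
have [/forallP/(_ i)|//] := boolP [forall j, (j \notin A) ==> (phi j == k0)].
rewrite iA /= => /eqP phi_i; congr (h _).
by apply/ffunP => j; rewrite !ffunE /=; case: eqP => [->|//]; rewrite ?ffunE phi_i.
Qed.

Let hA_step (A : {set I}) i F (x : X) : i \notin A ->
  hA (i |: A) (setcol i F x) = [forall k, g A i F (x k)].
Proof.
move=> iA; apply/forallP/forallP => [H k|H phi].
  apply/forallP => phi; apply/implyP => /forallP phiA.
  have := H [ffun j => if j == i then k else phi j].
  rewrite (_ : [forall j, _] = true) /=; last first.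
    apply/forallP => j; rewrite !inE negb_or ffunE.
    by case: (eqVneq j i) => //= _; apply: phiA.
  congr (h _); apply/ffunP => j; rewrite !ffunE /=.
  by case: eqP => // ji; rewrite ?ji ?ffunE ?eqxx.
apply/implyP => /forallP phiA.
have /forallP/(_ [ffun j => if j == i then k0 else phi j]) := H (phi i).
rewrite (_ : [forall j, _] = true) /=; last first.
  apply/forallP => j; rewrite ffunE; case: (eqVneq j i) => [_|ji]; first by rewrite eqxx implybT.
  by have := phiA j; rewrite !inE negb_or ji.
congr (h _); apply/ffunP => j; rewrite !ffunE /=.
by case: eqP => // ji; rewrite ?ji ?ffunE ?eqxx.
Qed.

Let N : R := #|V|%:R.
Let N0 : 0 < N. Proof. by rewrite ltr0n. Qed.

Let sum_at_k0 (u : V -> R) : N * \sum_(x : X) u (x k0) = #|X|%:R * \sum_v u v.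
Proof.
rewrite -(@sum_resample _ _ _ (fun x : X => x k0)
  (fun x v => [ffun k => if k == k0 then v else x k] : X)).
- under eq_bigr => x _ do under eq_bigr => v _ do rewrite ffunE eqxx.
  by rewrite sumr_const mulr_natl.
- by move=> x v; rewrite ffunE eqxx.
- by move=> x v; apply/ffunP => k; rewrite !ffunE; case: eqP => [->|].
Qed.

(** With all columns but [i] fixed, let [a F] be the proportion of vertices that fit as the single
    copy in column [i]. A column of independent copies fits with probability [a F ^ |K|], and
    convexity bounds the mean of this from below. *)
Let step (A : {set I}) i (d : R) : i \notin A -> 0 <= d ->
  d * #|FF|%:R <= \sum_F (hA A F)%:R ->
  d ^+ #|K| * #|FF|%:R <= \sum_F (hA (i |: A) F)%:R.
Proof.
move=> iA d0 le_d.
have X0 : 0 < #|X|%:R :> R by rewrite card_ffun natrX exprn_gt0.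
pose a F : R := (\sum_v (g A i F v)%:R) / N.
have a0 F : 0 <= a F by rewrite divr_ge0 ?sumr_ge0 // ltW.
have sum_a : \sum_F a F = \sum_F (hA A F)%:R.
  apply: (mulfI (lt0r_neq0 X0)).
  rewrite -[RHS](@sum_resample _ _ _ (getcol i) (setcol i)) // mulr_sumr.
  apply: eq_bigr => F _.
  under [RHS]eq_bigr => x _ do rewrite hA_base //.
  apply: (mulfI (lt0r_neq0 N0)); rewrite (sum_at_k0 (fun v => (g A i F v)%:R)) /a.
  by rewrite mulrCA [N * _]mulrC divfK ?gt_eqF.
have sum_aK : \sum_F a F ^+ #|K| = \sum_F (hA (i |: A) F)%:R.
  apply: (mulfI (lt0r_neq0 X0)).
  rewrite -[RHS](@sum_resample _ _ _ (getcol i) (setcol i)) // mulr_sumr.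
  apply: eq_bigr => F _.
  rewrite /a expr_div_n [#|X|%:R](_ : _ = N ^+ #|K|); last by rewrite card_ffun natrX.
  rewrite mulrC divfK ?expf_neq0 ?gt_eqF //.
  rewrite -[#|K|]cardsT -prodr_const big_mkcond /=.
  under eq_bigr do rewrite inE.
  rewrite (bigA_distr_bigA (fun _ v => (g A i F v)%:R)).
  apply: eq_bigr => x _; rewrite hA_step //.
  case: forallP => [H|/forallP]; first by rewrite big1 // => k _; rewrite H.
  by rewrite negb_forall => /existsP[k /negPf H]; rewrite (bigD1 k) //= H mul0r.
by rewrite -sum_aK; apply: power_mean => //; rewrite sum_a.
Qed.

(** Initially only the copies [k0] matter, and they form a uniform map from [I]. The parts are then
    blown up one after another; each round raises the density to the power [|K|], whence the
    exponent [|K|^|I|]. *)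
Lemma box_count (d : R) : 0 <= d -> d * N ^+ #|I| <= #|[set f | h f]|%:R ->
  d ^+ (#|K| ^ #|I|) * N ^+ (#|I| * #|K|) <=
    #|[set F : {ffun I * K -> V} | [forall phi, h (transversal F phi)]]|%:R.
Proof.
move=> d0 le_d.
have card_h := @card_set_pred R.
have base : d * #|FF|%:R <= \sum_F (hA set0 F)%:R.
  pose get (F : FF) : {ffun I -> V} := [ffun i => F (i, k0)].
  pose set (F : FF) (f : {ffun I -> V}) : FF :=
    [ffun ik => if ik.2 == k0 then f ik.1 else F ik].
  have -> : \sum_F (hA set0 F)%:R = \sum_F (h (get F))%:R :> R.
    apply: eq_bigr => F _; congr (nat_of_bool _)%:R; apply/forallP/idP => [H|hF phi].
      have := H [ffun=> k0]; rewrite (_ : [forall i, _] = true) /=; last first.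
        by apply/forallP => i; rewrite ffunE eqxx implybT.
      by congr (h _); apply/ffunP => i; rewrite !ffunE.
    apply/implyP => /forallP H; rewrite (_ : transversal _ _ = get F) //.
    by apply/ffunP => i; rewrite !ffunE; have := H i; rewrite inE => /eqP->.
  have NI0 : 0 < #|{ffun I -> V}|%:R :> R by rewrite card_ffun natrX exprn_gt0.
  have getset F f : get (set F f) = f.
    by apply/ffunP => i; rewrite !ffunE eqxx.
  rewrite -(ler_pM2l NI0) -(@sum_resample _ _ _ get set) //; last first.
    by move=> F f; apply/ffunP => -[i k]; rewrite !ffunE /=; case: eqP => [->|].
  under [leRHS]eq_bigr => F _ do under eq_bigr => f _ do rewrite getset.
  rewrite -card_h sumr_const mulrCA mulrA -[leRHS]mulr_natr ler_wpM2r //.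
  by rewrite card_ffun natrX.
have main (s : seq I) : uniq s ->
    d ^+ (#|K| ^ size s) * #|FF|%:R <= \sum_F (hA [set i in s] F)%:R.
  elim: s => [_|i s IH /= /andP[iS us]].
    by rewrite set_nil.
  rewrite expnSr exprM set_cons; apply: step; rewrite ?inE ?exprn_ge0 //.
  exact: IH.
have := main (enum I) (enum_uniq _); rewrite -cardE card_ffun card_prod natrX.
rewrite -/N => /le_trans; apply; rewrite card_h; apply: ler_sum => F _.
rewrite ler_nat; case: (boolP (hA _ F)) => // /forallP H.
rewrite (_ : [forall phi, _] = true) //; apply/forallP => phi.
have := H phi; rewrite (_ : [forall i, _] = true) //.
by apply/forallP => i; rewrite inE mem_enum.
Qed.

End Box.

(** Union bound over pairs of points: resampling the value at one of them shows that a given pair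
    collides for a proportion [1/|V|] of the maps. *)
Lemma card_noninjective (R : realFieldType) (D V : finType) :
  #|V|%:R * #|[set f : {ffun D -> V} | ~~ injectiveb f]|%:R
    <= #|D|%:R ^+ 2 * #|V|%:R ^+ #|D| :> R.
Proof.
have card_eq (a b : D) : a != b ->
    #|V|%:R * \sum_(f : {ffun D -> V}) (f a == f b)%:R = #|V|%:R ^+ #|D| :> R.
  move=> ab; rewrite -(@sum_resample _ _ _ (fun f : {ffun D -> V} => f a)
    (fun f v => [ffun d => if d == a then v else f d])).
  - rewrite -natrX -card_ffun -sum1_card natr_sum; apply: eq_bigr => f _.
    rewrite (bigD1 (f b)) //= big1 ?addr0 => [|v vb].
      by rewrite !ffunE eqxx [b == a]eq_sym (negPf ab) eqxx.
    by rewrite !ffunE eqxx [b == a]eq_sym (negPf ab) (negPf vb).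
  - by move=> f v; rewrite ffunE eqxx.
  - by move=> f v; apply/ffunP => d; rewrite !ffunE; case: eqP => [->|].
apply: le_trans (_ : \sum_(ab : D * D | ab.1 != ab.2)
    #|V|%:R * \sum_(f : {ffun D -> V}) (f ab.1 == f ab.2)%:R <= _).
  rewrite -mulr_sumr ler_wpM2l // exchange_big card_set_pred.
  apply: ler_sum => f _; have [fI|] := boolP (injectiveb f).
    by rewrite sumr_ge0.
  case/injectivePn => a [b ab fab]; rewrite (bigD1 (a, b)) //= fab eqxx.
  by rewrite lerDl sumr_ge0.
rewrite (eq_bigr (fun=> #|V|%:R ^+ #|D|)) => [|[a b] /= /card_eq //].
rewrite sumr_const -[leLHS]mulr_natl ler_wpM2r ?exprn_ge0 //.
by rewrite -natrX ler_nat (leq_trans (max_card _)) // card_prod.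
Qed.

Lemma nat_large (R : realType) (x : R) : exists N : nat, x <= N%:R.
Proof.
exists (Num.bound `|x|); apply: le_trans (ler_norm _) _.
by rewrite ltW // archi_boundP.
Qed.

Lemma card_injective_part (R : realType) (D : finType) (c : R) : 0 < c ->
  exists N : nat, forall (V : finType) (P : pred {ffun D -> V}), (N <= #|V|)%N ->
    c * #|V|%:R ^+ #|D| <= #|[set f | P f]|%:R ->
    c / 2 * #|V|%:R ^+ #|D| <= #|[set f : {ffun D -> V} | injectiveb f && P f]|%:R.
Proof.
move=> c0; have [N0 leN0] := nat_large (2 * #|D|%:R ^+ 2 / c).
exists N0.+1 => V P leN cP.
have V0 : 0 < #|V|%:R :> R by rewrite ltr0n (leq_trans _ leN).
have leV : #|D|%:R ^+ 2 <= c / 2 * #|V|%:R.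
  have : 2 * #|D|%:R ^+ 2 / c <= #|V|%:R.
    by apply: le_trans leN0 _; rewrite ler_nat ltnW.
  by rewrite ler_pdivrMr //; lra.
have splitP : #|[set f | P f]|%:R <= #|[set f : {ffun D -> V} | injectiveb f && P f]|%:R
    + #|[set f : {ffun D -> V} | ~~ injectiveb f]|%:R :> R.
  rewrite -natrD ler_nat -(cardsID [set f : {ffun D -> V} | injectiveb f]).
  apply: leq_add; apply: subset_leq_card; apply/subsetP => f; rewrite !inE.
    by rewrite andbC.
  by case/andP.
have : #|[set f : {ffun D -> V} | ~~ injectiveb f]|%:R
    <= c / 2 * #|V|%:R ^+ #|D| :> R.
  rewrite -(ler_pM2l V0); apply: le_trans (card_noninjective _ _ _) _.
  by rewrite mulrA ler_wpM2r ?exprn_ge0 // mulrC.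
by lra.
Qed.

Lemma box_count_injective (R : realType) (I K : finType) (k0 : K) (d : R) : 0 < d ->
  exists2 c : R, 0 < c & exists N : nat,
    forall (V : finType) (h : {ffun I -> V} -> bool), (N <= #|V|)%N ->
    d * #|V|%:R ^+ #|I| <= #|[set f | h f]|%:R ->
    c * #|V|%:R ^+ #|{: I * K}| <=
      #|[set F : {ffun I * K -> V} | injectiveb F &&
           [forall phi, h (transversal F phi)]]|%:R.
Proof.
move=> d0; pose c := d ^+ (#|K| ^ #|I|).
have c0 : 0 < c by rewrite exprn_gt0.
have [N HN] := @card_injective_part R (I * K)%type c c0.
exists (c / 2); first by rewrite divr_gt0.
exists N.+1 => V h leN dh; apply: HN; first exact: ltnW.
rewrite card_prod; apply: box_count => //; last exact: ltW.
exact: leq_ltn_trans leN.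
Qed.

Lemma box_exists (R : realType) (I K : finType) (k0 : K) (d : R) : 0 < d ->
  exists N : nat,
    forall (V : finType) (h : {ffun I -> V} -> bool), (N <= #|V|)%N ->
    d * #|V|%:R ^+ #|I| <= #|[set f | h f]|%:R ->
  exists2 F : {ffun I * K -> V}, injective F & forall phi, h (transversal F phi).
Proof.
move=> d0; have [c c0 [N HN]] := @box_count_injective R I K k0 d d0.
exists N.+1 => V h leN dh; have := HN V h (ltnW leN) dh.
set A := [set F | _] => cA; have /card_gt0P[F] : (0 < #|A|)%N.
  rewrite -(ltr0n R); apply: lt_le_trans cA; rewrite mulr_gt0 ?exprn_gt0 //.
  by rewrite ltr0n (leq_trans _ leN).
by rewrite inE => /andP[/injectiveP FI /forallP]; exists F.
Qed.

Lemma pigeonhole_density (R : realFieldType) (T C : finType) (P : pred T)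
    (col : T -> C) (x : R) : (0 < #|C|)%N ->
  x <= #|[set t | P t]|%:R ->
  exists c, x / #|C|%:R <= #|[set t | P t && (col t == c)]|%:R.
Proof.
move=> C0 le_x; apply/existsP; rewrite -[[exists c, _]]negbK negb_exists.
apply/negP => /forallP H.
have C0R : 0 < #|C|%:R :> R by rewrite ltr0n.
have : #|[set t | P t]|%:R = \sum_c #|[set t | P t && (col t == c)]|%:R :> R.
  rewrite -natr_sum; congr _%:R; rewrite -sum1_card.
  rewrite (partition_big col xpredT) //=; apply: eq_bigr => c _.
  by rewrite -sum1_card; apply: eq_bigl => t; rewrite !inE.
move=> E; move: le_x; rewrite E leNgt => /negP; apply.
rewrite -[ltRHS](divfK (lt0r_neq0 C0R)) [ltRHS]mulr_natr -sumr_const.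
have [c0 _] := card_gt0P C0.
apply: ltr_sum; first by apply/hasP; exists c0; rewrite ?mem_index_enum.
by move=> c _; rewrite ltNge H.
Qed.

(** Counting pairs of a tuple and a common neighbour from the side of the neighbour gives the sum of
    the [|D|]-th powers of the degrees, which convexity bounds from below. So a positive proportion
    of tuples has linearly many common neighbours. *)
Lemma common_neighbours (R : realType) (D : finType) (d : R) : 0 < d ->
  exists2 c : R, 0 < c & exists N : nat, forall (V : finType) (r : rel V),
    (N <= #|V|)%N ->
    d * #|V|%:R ^+ 2 <= \sum_w #|[set v | r v w]|%:R ->
    c * #|V|%:R ^+ #|D| <= #|[set f : {ffun D -> V} | injectiveb f &&
      (c * #|V|%:R <= #|[set w | [forall x, r (f x) w]]|%:R)]|%:R.
Proof.
move=> d0; pose c := d ^+ #|D| / 2.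
have c0 : 0 < c by rewrite divr_gt0 ?exprn_gt0.
have [N HN] := @card_injective_part R D c c0.
exists (c / 2); first by rewrite divr_gt0.
exists N.+1 => V r leN sum_deg.
have V0 : 0 < #|V|%:R :> R by rewrite ltr0n (leq_ltn_trans _ leN).
pose nb (f : {ffun D -> V}) := [set w | [forall x, r (f x) w]].
apply: HN; first exact: ltnW.
have lb : d ^+ #|D| * #|V|%:R ^+ #|D| * #|V|%:R <= \sum_f #|nb f|%:R :> R.
  have -> : \sum_f #|nb f|%:R = \sum_w #|[set v | r v w]|%:R ^+ #|D| :> R.
    under eq_bigr do rewrite card_set_pred.
    rewrite exchange_big; apply: eq_bigr => w _ /=.
    rewrite card_set_pred -[#|D|]cardsT -prodr_const [RHS]big_mkcond /=.
    under [RHS]eq_bigr do rewrite inE.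
    rewrite (bigA_distr_bigA (fun _ v => (r v w)%:R)); apply: eq_bigr => f _.
    case: forallP => [H|/forallP]; first by rewrite big1 // => x _; rewrite H.
    by rewrite negb_forall => /existsP[x /negPf H]; rewrite (bigD1 x) //= H mul0r.
  rewrite -exprMn; apply: power_mean => //; first by rewrite mulr_ge0 ?ltW.
  by rewrite -mulrA -expr2.
pose P f := c / 2 * #|V|%:R <= #|nb f|%:R.
(* Tuples with few common neighbours contribute at most [c / 2 * n] each, all others at most [n]. *)
have ub : \sum_f #|nb f|%:R <=
    #|[set f | P f]|%:R * #|V|%:R + c / 2 * #|V|%:R * #|V|%:R ^+ #|D|.
  rewrite -[_ ^+ #|D|]natrX -card_ffun [X in _ + X]mulr_natr
    -[X in _ + X]sumr_const (card_set_pred R P).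
  rewrite mulr_suml -big_split /=; apply: ler_sum => f _.
  rewrite /P; case: (lerP (c / 2 * #|V|%:R) _) => [_|/ltW]; last by rewrite mul0r add0r.
  rewrite /= mul1r -[leLHS]addr0 lerD ?ler_nat ?max_card //.
  by rewrite mulr_ge0 // divr_ge0 // ltW.
rewrite -(ler_pM2r V0) -[#|_|]/(#|[set f | P f]|).
set m := #|[set f | P f]|%:R in ub *; set n := #|V|%:R in V0 lb ub *.
have -> : c * n ^+ #|D| * n = (d ^+ #|D| * n ^+ #|D| * n) / 2 by rewrite /c; field.
have E : c / 2 * n * n ^+ #|D| = (d ^+ #|D| * n ^+ #|D| * n) / 4 by rewrite /c; field.
have : 0 <= d ^+ #|D| * n ^+ #|D| * n by rewrite !mulr_ge0 ?exprn_ge0 ?ltW.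
by move: lb ub; rewrite E; lra.
Qed.

(** * Supersaturation of cliques *)

Section Cliques.
Variables (R : realFieldType) (V : finType) (r : rel V).
Hypotheses (symr : symmetric r) (irr : irreflexive r).
Implicit Types (A B : {set V}).

Definition clique A : bool :=
  [forall x, forall y, [&& x \in A, y \in A & x != y] ==> r x y].

Definition cliques (s : nat) : {set {set V}} := [set A : {set V} | (#|A| == s) && clique A].

Definition extensions A : {set V} := [set w | [forall x, (x \in A) ==> r x w]].

Lemma cliqueP A : reflect {in A &, forall x y, x != y -> r x y} (clique A).
Proof.
apply: (iffP forallP) => [H x y xA yA xy|H x].
  by have /forallP/(_ y) := H x; rewrite xA yA xy.
by apply/forallP => y; apply/implyP => /and3P[xA yA xy]; apply: H.
Qed.

Lemma extensionsP A w : reflect {in A, forall x, r x w} (w \in extensions A).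
Proof. by rewrite inE; apply: (iffP forall_inP). Qed.

Lemma extensions_notin A w : w \in extensions A -> w \notin A.
Proof. by move=> /extensionsP H; apply/negP => /H; rewrite irr. Qed.

Lemma cliques_setD1 B w s : w \in B ->
  (B :\ w \in cliques s) && (w \in extensions (B :\ w)) = (B \in cliques s.+1).
Proof.
move=> wB; rewrite !in_set -andbA (cardsD1 w B) wB add1n eqSS; congr (_ && _).
apply/andP/cliqueP => [[/cliqueP cB /forall_inP eB] x y xB yB xy|cB].
  have [xw|xw] := eqVneq x w.
    by rewrite symr xw eB // !inE -xw eq_sym xy.
  have [yw|yw] := eqVneq y w; first by rewrite yw eB // !inE xw.
  by rewrite cB // !inE ?xw ?yw.
split; first by apply/cliqueP => x y /setD1P[_ xB] /setD1P[_ yB]; apply: cB.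
by apply/forall_inP => x /setD1P[xw xB]; apply: cB.
Qed.

(** Double counting: an [s]-clique with an extending vertex is the same as an [(s+1)]-clique with a
    chosen vertex. *)
Lemma sum_cliques_extensions (u : {set V} -> V -> R) s :
  \sum_(A in cliques s) \sum_(w in extensions A) u A w
    = \sum_(B in cliques s.+1) \sum_(w in B) u (B :\ w) w.
Proof.
rewrite !pair_big_dep /=.
rewrite (reindex_onto (fun p => (p.1 :\ p.2, p.2)) (fun p => (p.2 |: p.1, p.2))) /=.
  apply: eq_big => [[B w] /=|[B w] //].
  have [wB|wB] := boolP (w \in B); last first.
    rewrite andbF; apply/negbTE; rewrite negb_and; apply/orP; right.
    apply: contraNneq wB => -[<-]; exact: setU11.
  by rewrite cliques_setD1 // setD1K // eqxx !andbT.
by case=> A w /= /andP[_ /extensions_notin wA]; rewrite setU1K.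
Qed.

Lemma sum_card_extensions s :
  \sum_(A in cliques s) #|extensions A|%:R = s.+1%:R * #|cliques s.+1|%:R :> R.
Proof.
have := sum_cliques_extensions (fun _ _ => 1) s.
under eq_bigr do rewrite sumr_const.
move=> ->; rewrite mulr_natr -sumr_const; apply: eq_bigr => B.
by rewrite sumr_const inE => /andP[/eqP-> _].
Qed.

(* For a clique [B] and a vertex [x] not adjacent to all of [B], at most one
   [w] in [B] can be exchanged for [x]. *)
Lemma sum_exchange s B : B \in cliques s.+1 ->
  \sum_(w in B) #|extensions (B :\ w)|%:R
    <= #|V|%:R + s%:R * #|extensions B|%:R :> R.
Proof.
rewrite inE => /andP[/eqP cB _].
have cardE (A : {set V}) : #|A|%:R = \sum_x (x \in A)%:R :> R.
  by rewrite -sum1_card natr_sum big_mkcond; apply: eq_bigr => x _; case: (x \in A).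
under eq_bigr do rewrite cardE.
rewrite exchange_big /= cardE mulr_sumr -sum1_card natr_sum -big_split /=.
apply: ler_sum => x _; have [xB|] := boolP (x \in extensions B).
  apply: le_trans (_ : \sum_(w in B) 1 <= _).
    by apply: ler_sum => w _; rewrite lern1 leq_b1.
  by rewrite sumr_const cB -natrM -natrD ler_nat /= muln1.
rewrite inE mulr0 addr0 => /forall_inPn[y yB nyx].
rewrite (bigD1 y) //= big1 ?addr0 ?lern1 ?leq_b1 // => w /andP[wB wy].
rewrite (_ : (x \in _) = false) //; apply: contraNF nyx => /extensionsP -> //.
by rewrite !inE eq_sym wy.
Qed.

(* The Moon-Moser inequality. *)
Lemma clique_growth s (d : R) : 0 <= d ->
  d * #|cliques s|%:R <= s.+1%:R * #|cliques s.+1|%:R ->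
  (d * s.+1%:R - #|V|%:R) * #|cliques s.+1|%:R
    <= s%:R * (s.+2%:R * #|cliques s.+2|%:R).
Proof.
move=> d0 dk; have sumE := sum_card_extensions.
(* Double counting turns the sum of squares into a sum over [(s+1)]-cliques, to which the exchange
   bound applies. *)
have sq : \sum_(A in cliques s) #|extensions A|%:R ^+ 2
    <= #|V|%:R * #|cliques s.+1|%:R + s%:R * (s.+2%:R * #|cliques s.+2|%:R) :> R.
  have := sum_cliques_extensions (fun A _ => #|extensions A|%:R) s.
  under eq_bigr => A _ do rewrite sumr_const -[_ *+ _]mulr_natr -expr2.
  move=> ->; apply: le_trans (ler_sum _ (fun B => @sum_exchange s B)) _.
  by rewrite big_split sumr_const -mulr_sumr -sumE mulr_natr.
(* Cauchy-Schwarz in linear form, [x^2 >= 2 d x - d^2]. *)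
have : \sum_(A in cliques s) (2 * d * #|extensions A|%:R - d ^+ 2)
    <= \sum_(A in cliques s) #|extensions A|%:R ^+ 2.
  by apply: ler_sum => A _; rewrite -subr_ge0
    -[X in 0 <= X](_ : (#|extensions A|%:R - d) ^+ 2 = _) ?sqr_ge0 //; ring.
rewrite big_split -mulr_sumr sumE /= sumr_const -[_ *+ _]mulr_natr.
move: dk => /(ler_wpM2l d0); move: sq.
set k1 := #|_|%:R; set k2 := #|_|%:R; set k3 := \sum_(A in _) _.
by nra.
Qed.

Lemma many_cliques (q : nat) (e : R) : (0 < q)%N -> 0 < e ->
  (1 - q%:R^-1 + e) * #|V|%:R ^+ 2 <= \sum_w #|[set v | r v w]|%:R ->
  (e / q.+1%:R) ^+ q * #|V|%:R ^+ q.+1 <= #|cliques q.+1|%:R.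
Proof.
move=> q0 e0 deg.
have q0R : 0 < q%:R :> R by rewrite ltr0n.
have cliques1 : cliques 1 = [set [set x] | x : V].
  apply/setP => A; rewrite inE; apply/andP/imsetP => [[/cards1P[x ->] _]|[x _ ->]].
    by exists x.
  rewrite cards1; split=> //; apply/cliqueP => y z /set1P-> /set1P->.
  by rewrite eqxx.
have card1 : #|cliques 1| = #|V|.
  by rewrite cliques1 card_imset //; apply: set1_inj.
(* [beta s * n] bounds from below the average number of extensions of an [s]-clique. It decreases
   linearly and is still at least [e * n] at [s = q]. *)
pose beta s : R := 1 - s%:R / q%:R + e.
have beta_ge s : (s <= q)%N -> e <= beta s.
  move=> sq; rewrite /beta -subr_ge0 addrK subr_ge0 ler_pdivrMr // mul1r.
  by rewrite ler_nat.
have growth s : (s < q)%N -> beta s.+1 * #|V|%:R * #|cliques s.+1|%:R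
    <= s.+2%:R * #|cliques s.+2|%:R.
  elim: s => [_|s IH sq].
    rewrite card1 -sum_card_extensions -mulrA -expr2 [beta 1](_ : _ = 1 - q%:R^-1 + e).
      apply: le_trans deg _.
      rewrite cliques1.
      rewrite big_imset /=; last by move=> x y _ _; apply: set1_inj.
      apply: ler_sum => x _; rewrite ler_nat; apply: subset_leq_card.
      apply/subsetP => v; rewrite inE => vx; apply/extensionsP => y /set1P->.
      by rewrite symr.
    by rewrite /beta mul1r.
  have b0 : 0 <= beta s.+1 * #|V|%:R.
    by rewrite mulr_ge0 // (le_trans (ltW e0)) // beta_ge // ltnW.
  have := clique_growth b0 (IH (ltnW sq)).
  set k2 := #|cliques s.+2|%:R; set k3 := _ * #|_|%:R => H.
  have s0 : 0 < s.+1%:R :> R by rewrite ltr0n.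
  rewrite -(ler_pM2l s0); apply: le_trans H.
  rewrite mulrA ler_wpM2r // -subr_ge0.
  rewrite (_ : _ - _ = e * #|V|%:R); first by rewrite mulr_ge0 // ltW.
  by rewrite /beta -!natr1; field; rewrite gt_eqF.
have main s : (s <= q)%N ->
    (e / q.+1%:R) ^+ s * #|V|%:R ^+ s.+1 <= #|cliques s.+1|%:R.
  elim: s => [_|s IH sq]; first by rewrite card1 mul1r.
  have s0 : 0 < s.+2%:R :> R by rewrite ltr0n.
  have Q0 : 0 < q.+1%:R :> R by rewrite ltr0n.
  have k0 : 0 <= #|V|%:R * #|cliques s.+1|%:R :> R by rewrite mulr_ge0.
  rewrite -(ler_pM2l s0); apply: le_trans (growth _ sq).
  apply: le_trans (_ : e * (#|V|%:R * #|cliques s.+1|%:R) <= _); last first.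
    by rewrite -mulrA ler_wpM2r // beta_ge.
  rewrite exprS [#|V|%:R ^+ _]exprS.
  have -> (x y z u v w : R) : x * (y / z * u * (v * w)) = y * (x / z) * (v * (u * w)).
    by ring.
  rewrite -mulrA ler_pM2l // -[leRHS]mul1r; apply: ler_pM.
  - by rewrite divr_ge0 // ltW.
  - by rewrite mulr_ge0 // mulr_ge0 // exprn_ge0 // divr_ge0 // ltW.
  - by rewrite ler_pdivrMr // mul1r ler_nat.
  - by rewrite ler_wpM2l // IH // ltnW.
exact: main.
Qed.

End Cliques.

(** * Clique tuples in dense graphs and their blow-ups *)

Definition clique_tuple {n} (G : graph n) {I : finType} (f : {ffun I -> 'I_n}) : bool :=
  [forall i, forall j, (i != j) ==> adj G (f i) (f j)].

Lemma clique_tupleP n (G : graph n) (I : finType) (f : {ffun I -> 'I_n}) :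
  reflect (forall i j, i != j -> adj G (f i) (f j)) (clique_tuple G f).
Proof.
apply: (iffP forallP) => [H i j ij|H i]; first by have /forallP/(_ j) := H i; rewrite ij.
by apply/forallP => j; apply/implyP; apply: H.
Qed.

Lemma leq_cliques_tuples n (G : graph n) s :
  (#|cliques (adj G) s| <= #|[set f : {ffun 'I_s -> 'I_n} | clique_tuple G f]|)%N.
Proof.
apply: leq_trans (leq_imset_card (fun f : {ffun 'I_s -> 'I_n} => [set f i | i : 'I_s]) _).
apply/subset_leq_card/subsetP => A; rewrite inE => /andP[/eqP cA /cliqueP clA].
have memA (i : 'I_s) : val i \in iota 0 #|A| by rewrite mem_iota cA ltn_ord.
pose f := [ffun i : 'I_s => enum_val (cast_ord (esym cA) i)].
have fI : injective f.
  by move=> i j; rewrite !ffunE => /enum_val_inj/cast_ord_inj.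
apply/imsetP; exists f.
  rewrite inE; apply/clique_tupleP => i j ij.
  by apply: clA; rewrite ?(inj_eq fI) // ffunE enum_valP.
apply/esym/eqP; rewrite eqEcard card_imset // card_ord cA leqnn andbT.
by apply/subsetP => _ /imsetP[i _ ->]; rewrite ffunE enum_valP.
Qed.

Lemma degree_sum (R : realType) n (G : graph n) :
  \sum_w #|[set v | adj G v w]|%:R = 2 * (nedges G)%:R :> R.
Proof.
have symG : symmetric (adj G) by move=> x y; apply: adjC.
have irrG : irreflexive (adj G) by move=> x; rewrite /adj eqxx.
rewrite /nedges -natrM mul2n -(card_sym_rel symG irrG).
rewrite (card_set_pred R (fun e => adj G e.1 e.2)).
rewrite -(pair_bigA _ (fun x y => (adj G x y)%:R)) exchange_big /=.
by apply: eq_bigr => w _; rewrite card_set_pred.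
Qed.

(** The gap between [d'] and [d] absorbs the difference between [n (n - 1)] and [n^2]. *)
Lemma dense_degree_sum (R : realType) (d' d : R) : 0 < d -> d' < d ->
  exists N : nat, forall n (G : graph n), (N <= n)%N -> d <= density G ->
    d' * n%:R ^+ 2 <= \sum_w #|[set v | adj G v w]|%:R.
Proof.
move=> d0 dd; have [N leN] := nat_large (d / (d - d')).
exists N.+2 => n G leNn; have n2 : (1 < n)%N by apply: leq_trans leNn.
have n1 : (0 < n)%N by apply: ltnW.
have b0 : 0 < ('C(n, 2))%:R :> R by rewrite ltr0n bin_gt0.
rewrite /density ler_pdivlMr // degree_sum => dens.
have bE : 2 * ('C(n, 2))%:R = n%:R * (n%:R - 1) :> R.
  have -> : n%:R - 1 = n.-1%:R :> R by rewrite -[in LHS](prednK n1) -natr1 addrK.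
  by rewrite -!natrM bin2 mul2n halfK -subn1; congr (_%:R);
    case: n n1 {leNn n2 b0 dens G} => // m _; rewrite subn1 /= oddM /= andNb subn0.
have : d / (d - d') <= n%:R.
  by apply: le_trans leN _; rewrite ler_nat ltnW // ltnW.
rewrite ler_pdivrMr ?subr_gt0 // => dn.
have n0 : 0 <= n%:R :> R by [].
apply: le_trans (_ : 2 * (d * ('C(n, 2))%:R) <= _); last by rewrite ler_pM2l.
by rewrite [leRHS]mulrCA bE; nra.
Qed.

Lemma dense_clique_tuples (R : realType) (q : nat) (d : R) : (0 < q)%N ->
  0 < d -> 1 - q%:R^-1 < d ->
  exists2 c : R, 0 < c & exists N : nat, forall n (G : graph n), (N <= n)%N ->
    d <= density G ->
    c * n%:R ^+ q.+1 <= #|[set f : {ffun 'I_q.+1 -> 'I_n} | clique_tuple G f]|%:R.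
Proof.
move=> q0 d0 dq; pose e := (d - (1 - q%:R^-1)) / 2.
have e0 : 0 < e by rewrite divr_gt0 ?subr_gt0.
have [N HN] : exists N : nat, forall n (G : graph n), (N <= n)%N -> d <= density G ->
    (1 - q%:R^-1 + e) * n%:R ^+ 2 <= \sum_w #|[set v | adj G v w]|%:R.
  by apply: dense_degree_sum => //; rewrite /e; lra.
exists ((e / q.+1%:R) ^+ q); first by rewrite exprn_gt0 // divr_gt0.
exists N => n G leN dG.
have symG : symmetric (adj G) by move=> x y; apply: adjC.
have irrG : irreflexive (adj G) by move=> x; rewrite /adj eqxx.
apply: le_trans (_ : #|cliques (adj G) q.+1|%:R <= _); last first.
  by rewrite ler_nat leq_cliques_tuples.
have := many_cliques symG irrG q0 e0; rewrite card_ord; apply.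
exact: HN.
Qed.

(** Pigeonhole over the finitely many colour patterns keeps a positive proportion of the clique
    tuples, and the box argument is applied to the tuples of one pattern. *)
Lemma coloured_blowup (R : realType) (q : nat) (d : R) (K : finType) (k0 : K) :
    (0 < q)%N -> 0 < d -> 1 - q%:R^-1 < d ->
  exists N : nat, forall n (G : graph n) (c : colouring n), (N <= n)%N ->
    d <= density G ->
  exists2 F : {ffun 'I_q.+1 * K -> 'I_n}, injective F &
  exists chi : 'I_q.+1 -> 'I_q.+1 -> bool, forall i j a b, i != j ->
    adj G (F (i, a)) (F (j, b)) /\ Defs.col c (F (i, a)) (F (j, b)) = chi i j.
Proof.
move=> q0 d0 dq; have [x x0 [N HN]] := dense_clique_tuples q0 d0 dq.
pose pat := {ffun 'I_q.+1 * 'I_q.+1 -> bool}.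
have pat0 : (0 < #|{: pat}|)%N by apply/card_gt0P; exists [ffun=> true].
have y0 : 0 < x / #|{: pat}|%:R by rewrite divr_gt0 ?ltr0n.
have [M HM] := @box_exists R 'I_q.+1 K k0 _ y0.
exists (maxn N M) => n G c; rewrite geq_max => /andP[leN leM] dG.
pose pt (f : {ffun 'I_q.+1 -> 'I_n}) : pat := [ffun ij => Defs.col c (f ij.1) (f ij.2)].
have [chi Hchi] := pigeonhole_density pt pat0 (HN n G leN dG).
have [||F FI HF] := HM _ (fun f => clique_tuple G f && (pt f == chi)).
- by rewrite card_ord.
- by rewrite !card_ord mulrAC.
exists F => //; exists (fun i j => chi (i, j)) => i j a b ij.
(* The transversal through copy [a] of part [i] and copy [b] of all other parts contains the given
   pair. *)
have := HF [ffun l => if l == i then a else b].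
case/andP => /clique_tupleP/(_ i j ij); rewrite !ffunE eqxx eq_sym (negPf ij) => Hadj.
move=> /eqP/ffunP/(_ (i, j)); rewrite !ffunE /= eqxx eq_sym (negPf ij) => <-.
by [].
Qed.

(** No colouring enters here: the second moment method needs a family fixed before the random edges,
    while the colouring is chosen after them. *)
Lemma many_blowups (R : realType) (q : nat) (d : R) (K : finType) (k0 : K) :
    (0 < q)%N -> 0 < d -> 1 - q%:R^-1 < d ->
  exists2 c : R, 0 < c & exists N : nat, forall n (G : graph n), (N <= n)%N ->
    d <= density G ->
    c * n%:R ^+ #|{: 'I_q.+1 * K}| <= #|[set F : {ffun 'I_q.+1 * K -> 'I_n} |
      injectiveb F && [forall s, forall t, (s.1 != t.1) ==> adj G (F s) (F t)]]|%:R.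
Proof.
move=> q0 d0 dq; have [x x0 [N HN]] := dense_clique_tuples q0 d0 dq.
have [c c0 [M HM]] := @box_count_injective R 'I_q.+1 K k0 _ x0.
exists c => //; exists (maxn N M) => n G; rewrite geq_max => /andP[leN leM] dG.
have := HM 'I_n (fun f => clique_tuple G f); rewrite !card_ord => /(_ leM (HN n G leN dG)).
move=> /le_trans; apply; rewrite ler_nat; apply/subset_leq_card/subsetP => F.
rewrite !inE => /andP[-> /forallP HF] /=.
apply/forallP => -[i a]; apply/forallP => -[j b]; apply/implyP => /= ij.
have /clique_tupleP/(_ i j ij) := HF [ffun l => if l == i then a else b].
by rewrite !ffunE eqxx eq_sym (negPf ij).
Qed.

(** * Monochromatic cycles *)

Lemma colC n (c : colouring n) x y : Defs.col c x y = Defs.col c y x.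
Proof. by rewrite /Defs.col; case: ltngtP => // /val_inj->. Qed.

Section MonoCycles.
Variables (n : nat) (G : graph n) (c : colouring n) (b : bool).

Definition mono (x y : 'I_n) : bool := adj G x y && (Defs.col c x y == b).

Lemma monoC x y : mono x y = mono y x.
Proof. by rewrite /mono adjC colC. Qed.

Lemma mono_neq x y : mono x y -> x != y.
Proof. by case/andP => /adj_neq. Qed.

Lemma mono_cycle_nat (m : nat) (v : nat -> 'I_n) : (0 < m)%N ->
    (forall i j, (i < m)%N -> (j < m)%N -> v i = v j -> i = j) ->
    (forall i, (i.+1 < m)%N -> mono (v i) (v i.+1)) -> mono (v m.-1) (v 0%N) ->
  has_mono_cycle G c b m.
Proof.
move=> m0 vI vS vl; apply/existsP; exists [ffun i : 'I_m => v i].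
apply/andP; split.
  by apply/injectiveP => i j; rewrite !ffunE => /vI H; apply/val_inj/H.
apply/forallP => i; rewrite !ffunE -/(mono _ _) /=.
have := ltn_ord i; rewrite leq_eqVlt => /orP[/eqP E|lt_im].
  have -> : (i : nat) = m.-1 by apply: succn_inj; rewrite E prednK.
  by rewrite prednK // modnn.
by rewrite modn_small // vS.
Qed.

(** One edge inside [P] makes a cycle alternating between [P] and [Q] odd. It uses [m./2 + 1]
    vertices of [P] and [m./2] of [Q]; the two sets are disjoint because adjacent vertices
    differ. *)
Lemma odd_cycle (m : nat) (P Q : {set 'I_n}) (x x' : 'I_n) :
    odd m -> (3 <= m)%N -> (m./2 < #|P|)%N -> (m./2 <= #|Q|)%N ->
    x \in P -> x' \in P -> mono x x' ->
    (forall p q, p \in P -> q \in Q -> mono p q) ->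
  has_mono_cycle G c b m.
Proof.
move=> oddm m3 cP cQ xP x'P xx' PQ; set h := m./2 in cP cQ.
have mE : m = h.*2.+1 by rewrite -(odd_double_half m) oddm.
have xNx' := mono_neq xx'.
pose ps := [:: x, x' & enum (P :\ x :\ x')]; pose qs := enum Q.
have ps_uniq : uniq ps.
  by rewrite /= enum_uniq !inE !mem_enum !inE !eqxx (negPf xNx') /= ?andbF.
have size_ps : size ps = #|P|.
  rewrite /= -cardE (cardsD1 x P) xP (cardsD1 x' (P :\ x)).
  by rewrite !inE eq_sym xNx' x'P.
have ps_P i : (i <= h)%N -> nth x ps i \in P.
  move=> ih; have : nth x ps i \in ps by rewrite mem_nth // size_ps (leq_ltn_trans ih).
  by rewrite !inE => /or3P[/eqP->|/eqP->|] //; rewrite mem_enum !inE => /and3P[].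
have qs_Q i : (i < h)%N -> nth x qs i \in Q.
  by move=> ih; rewrite -mem_enum mem_nth // -cardE (leq_trans ih).
have ps_inj i j : (i <= h)%N -> (j <= h)%N -> nth x ps i = nth x ps j -> i = j.
  by move=> ih jh /eqP; rewrite nth_uniq // ?size_ps
    ?(leq_ltn_trans ih) ?(leq_ltn_trans jh) // => /eqP.
have qs_inj i j : (i < h)%N -> (j < h)%N -> nth x qs i = nth x qs j -> i = j.
  by move=> ih jh /eqP; rewrite nth_uniq ?enum_uniq // -?cardE
    ?(leq_trans ih) ?(leq_trans jh) // => /eqP.
have psqs i j : (i <= h)%N -> (j < h)%N -> nth x ps i <> nth x qs j.
  move=> ih jh E; have := mono_neq (PQ _ _ (ps_P i ih) (qs_Q j jh)).
  by rewrite E eqxx.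
(* The cycle is [x, x', q_0, p_2, q_1, p_3, ..., p_h, q_(h-1)]. *)
pose v j := if odd j then nth x ps j./2.+1 else
            if j./2 is i.+1 then nth x qs i else x.
have h0 : (0 < h)%N by rewrite mE in m3; case: (h) m3.
have vodd i : v i.*2.+1 = nth x ps i.+1.
  by rewrite /v /= odd_double /= uphalf_double.
have veven i : v i.+1.*2 = nth x qs i.
  by rewrite /v odd_double doubleK.
have parity (i : nat) : i = 0%N \/ (exists j, i = j.*2.+1) \/ (exists j, i = j.+1.*2).
  rewrite -(odd_double_half i); case: (odd i) => /=; first by right; left; exists i./2.
  by case: i./2 => [|j]; [left|right; right; exists j].
apply: (@mono_cycle_nat m v); first by rewrite mE.
- rewrite mE => i j; case: (parity i) => [->|[[i' ->]|[i' ->]]];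
    case: (parity j) => [->|[[j' ->]|[j' ->]]]; rewrite ?vodd ?veven // => im jm.
  + by move/(ps_inj 0%N); lia.
  + by move/(psqs 0%N); lia.
  + by move/esym/(ps_inj 0%N); lia.
  + by move/ps_inj; lia.
  + by move/psqs; lia.
  + by move/esym/(psqs 0%N); lia.
  + by move/esym/psqs; lia.
  + by move/qs_inj; lia.
- rewrite mE => i; case: (parity i) => [->|[[i' ->]|[i' ->]]] im //.
  + rewrite vodd -[i'.*2.+2]/(i'.+1.*2) veven PQ ?ps_P ?qs_Q //; lia.
  + rewrite veven vodd monoC PQ ?ps_P ?qs_Q //; lia.
- by rewrite mE /= -[h in v h.*2](prednK h0) veven monoC PQ // qs_Q // ltn_predL.
Qed.

Lemma even_cycle (m : nat) (P Q : {set 'I_n}) :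
    ~~ odd m -> (3 <= m)%N -> (m./2 <= #|P|)%N -> (m./2 <= #|Q|)%N ->
    (forall p q, p \in P -> q \in Q -> mono p q) ->
  has_mono_cycle G c b m.
Proof.
move=> evm m3 cP cQ PQ; set h := m./2 in cP cQ.
have mE : m = h.*2 by rewrite -(odd_double_half m) (negPf evm).
have h0 : (0 < h)%N by rewrite mE in m3; case: (h) m3.
have [x0 _] : exists x, x \in P by apply/card_gt0P; apply: leq_trans cP.
have mem_enumP (A : {set 'I_n}) i : (h <= #|A|)%N -> (i < h)%N -> nth x0 (enum A) i \in A.
  by move=> cA ih; rewrite -mem_enum mem_nth // -cardE (leq_trans ih).
have enum_inj (A : {set 'I_n}) i j : (h <= #|A|)%N -> (i < h)%N -> (j < h)%N ->
    nth x0 (enum A) i = nth x0 (enum A) j -> i = j.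
  by move=> cA ih jh /eqP; rewrite nth_uniq ?enum_uniq // -?cardE
    ?(leq_trans ih) ?(leq_trans jh) // => /eqP.
have PNQ i j : (i < h)%N -> (j < h)%N -> nth x0 (enum P) i <> nth x0 (enum Q) j.
  move=> ih jh E; have := mono_neq (PQ _ _ (mem_enumP P i cP ih) (mem_enumP Q j cQ jh)).
  by rewrite E eqxx.
pose v j := nth x0 (if odd j then enum Q else enum P) j./2.
have vodd i : v i.*2.+1 = nth x0 (enum Q) i.
  by rewrite /v /= odd_double /= uphalf_double.
have veven i : v i.*2 = nth x0 (enum P) i.
  by rewrite /v odd_double doubleK.
have parity (i : nat) : (exists j, i = j.*2.+1) \/ (exists j, i = j.*2).
  by rewrite -(odd_double_half i); case: (odd i); [left|right]; exists i./2.
apply: (@mono_cycle_nat m v); first by rewrite mE double_gt0.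
- rewrite mE => i j; case: (parity i) => [[i' ->]|[i' ->]];
    case: (parity j) => [[j' ->]|[j' ->]]; rewrite ?vodd ?veven // => im jm.
  + by move/enum_inj => H; rewrite H //; lia.
  + by move/esym/PNQ; lia.
  + by move/PNQ; lia.
  + by move/enum_inj => H; rewrite H //; lia.
- rewrite mE => i; case: (parity i) => [[i' ->]|[i' ->]] im.
  + by rewrite vodd -[i'.*2.+2]/(i'.+1.*2) veven monoC PQ ?mem_enumP //; lia.
  + by rewrite vodd veven PQ ?mem_enumP //; lia.
- rewrite mE -[h](prednK h0) doubleS /= vodd -[0%N]/(0.*2)%N veven monoC.
  by rewrite PQ ?mem_enumP // ltn_predL.
Qed.

(** A closed walk in the pattern lifts to a cycle: using copy [i] at time [i] keeps the vertices
    distinct even when the walk returns to a part. *)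
Lemma walk_cycle (m K : nat) (I : finType) (F : {ffun I * 'I_K.+1 -> 'I_n})
    (W : nat -> I) : (0 < m <= K.+1)%N -> injective F ->
    (forall i, (i.+1 < m)%N -> forall a a', mono (F (W i, a)) (F (W i.+1, a'))) ->
    (forall a a', mono (F (W m.-1, a)) (F (W 0%N, a'))) ->
  has_mono_cycle G c b m.
Proof.
case/andP=> m0 mK FI WS Wl.
apply: (@mono_cycle_nat m (fun i => F (W i, inord i))) => //.
- move=> i j im jm /FI[_ /(congr1 val)]; rewrite /= !inordK //.
  + exact: leq_trans jm mK.
  + exact: leq_trans im mK.
- by move=> i im; apply: WS.
Qed.

End MonoCycles.

(** * Two-colourings of K_5 and K_6 *)

(** A colouring of [K_r] is stored as a sequence of bits indexed by pairs, so that all [2^15]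
    colourings of [K_6] and all [2^10] of [K_5] can be checked by [vm_compute]. *)
Fixpoint all_bitseqs (m : nat) (P : seq bool -> bool) : bool :=
  if m is m'.+1 then
    all_bitseqs m' (fun s => P (true :: s)) && all_bitseqs m' (fun s => P (false :: s))
  else P [::].

Lemma all_bitseqsP m P s : all_bitseqs m P -> size s = m -> P s.
Proof.
elim: m P s => [|m IH] P [|b s] //= /andP[Ht Hf] [sz].
by case: b; [apply: (IH (fun s => P (true :: s)))|apply: (IH (fun s => P (false :: s)))].
Qed.

Definition index_pairs (r : nat) : seq (nat * nat) :=
  [seq (i, j) | j <- iota 0 r, i <- iota 0 j].

Definition position (r i j : nat) : nat :=
  index (if (i < j)%N then (i, j) else (j, i)) (index_pairs r).

Definition tabulate (r : nat) (e : nat -> nat -> bool) : seq bool :=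
  [seq e ij.1 ij.2 | ij <- index_pairs r].

Lemma nth_tabulate r e i j : (forall x y, e x y = e y x) ->
  (i < r)%N -> (j < r)%N -> i != j -> nth false (tabulate r e) (position r i j) = e i j.
Proof.
move=> sym_e ir jr ij; rewrite /position /tabulate.
have in_pairs x y : (x < y)%N -> (y < r)%N -> (x, y) \in index_pairs r.
  by move=> xy yr; apply/allpairsPdep; exists y, x; rewrite !mem_iota !add0n.
case: ltnP => [lt_ij|le_ji].
  by rewrite (nth_map (0, 0)%N) ?index_mem ?nth_index ?in_pairs.
have lt_ji : (j < i)%N by rewrite ltn_neqAle eq_sym ij.
by rewrite (nth_map (0, 0)%N) ?index_mem ?nth_index ?in_pairs.
Qed.

Definition triples (r : nat) : seq (nat * nat * nat) :=
  [seq t <- [seq (xy, z) | xy <- index_pairs r, z <- iota 0 r]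
   | (t.2 != t.1.1) && (t.2 != t.1.2)].

(* Vertices [2 i] and [2 i + 1] of [K_6] form a pair; the third vertex of a
   crossing triple is not paired with the other two. *)
Definition crossing_triples : seq (nat * nat * nat) :=
  [seq t <- triples 6 | (t.2./2 != t.1.1./2) && (t.2./2 != t.1.2./2)].

Definition triple_positions (r : nat) (t : nat * nat * nat) : nat * nat * nat :=
  (position r t.1.1 t.1.2, position r t.1.1 t.2, position r t.1.2 t.2).

(* [||] would evaluate both of its arguments under call by value. *)
Fixpoint lazy_has {T : Type} (P : T -> bool) (s : seq T) : bool :=
  if s is x :: s' then if P x then true else lazy_has P s' else false.

Lemma lazy_hasE T (P : T -> bool) s : lazy_has P s = has P s.
Proof. by elim: s => //= x s ->. Qed.

Definition constant_at (s : seq bool) (p : nat * nat * nat) : bool :=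
  if nth false s p.1.1 then nth false s p.1.2 && nth false s p.2
  else ~~ nth false s p.1.2 && ~~ nth false s p.2.

Lemma constant_atP (e : nat -> nat -> bool) r t : (forall x y, e x y = e y x) ->
    t \in triples r -> constant_at (tabulate r e) (triple_positions r t) ->
  [/\ (t.1.1 < r)%N, (t.1.2 < r)%N & (t.2 < r)%N] /\
  [/\ t.1.1 != t.1.2, t.2 != t.1.1 & t.2 != t.1.2] /\
  (e t.1.1 t.2 = e t.1.1 t.1.2 /\ e t.1.2 t.2 = e t.1.1 t.1.2).
Proof.
move=> sym_e; case: t => [[x y] z].
rewrite mem_filter => /andP[ne /allpairsP[[[x' y'] z'] /= [xy_in z_in E]]].
case: E ne => -> -> -> /= {x y z} /andP[zx zy].
have /allpairsPdep[y [x [y_in x_in [Ex Ey]]]] := xy_in.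
move: y_in x_in z_in zx zy; rewrite Ex Ey !mem_iota !add0n.
move: z' => z /= yr xy zr zx zy; have xr := ltn_trans xy yr.
have xNy : x != y by rewrite neq_ltn xy.
have xNz : x != z by rewrite eq_sym.
have yNz : y != z by rewrite eq_sym.
rewrite /constant_at !nth_tabulate // => H; do 3!split=> //.
  by move: H; case: (e x y); case: (e x z).
by move: H; case: (e x y); case: (e x z); case: (e y z).
Qed.

(** Evaluated beforehand, so that the exhaustive check does not recompute the positions for every
    colouring. *)
Definition crossing_positions :=
  Eval vm_compute in [seq triple_positions 6 t | t <- crossing_triples].

Lemma crossing_positionsE :
  crossing_positions = [seq triple_positions 6 t | t <- crossing_triples].
Proof. by vm_compute. Qed.

Lemma crossing_check :
  all_bitseqs 15 (fun s => lazy_has (constant_at s) crossing_positions).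
Proof. by vm_compute. Qed.

(** A triangle contains at most one of the pairs [{0,1}], [{2,3}], [{4,5}], so one vertex of a
    monochromatic triangle can serve as [z]. The form suits vertices whose pairs are joined only by
    random matching edges: at most the edge [xy] is of that kind. *)
Lemma ramsey_6_crossing (e : nat -> nat -> bool) : (forall x y, e x y = e y x) ->
  exists x y z, [/\ (x < 6)%N, (y < 6)%N & (z < 6)%N] /\
    [/\ x != y, z./2 != x./2 & z./2 != y./2] /\ (e x z = e x y /\ e y z = e x y).
Proof.
move=> sym_e.
have := all_bitseqsP crossing_check (erefl : size (tabulate 6 e) = 15%N).
rewrite crossing_positionsE.
rewrite lazy_hasE => /hasP[p /mapP[t]].
rewrite mem_filter => /andP[/andP[zx zy] t_in] -> /(constant_atP sym_e t_in).
by case=> [lt6 [[xy _ _] eqs]]; exists t.1.1, t.1.2, t.2.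
Qed.

Definition pentagon (f : nat -> nat -> bool) (s : seq nat) : bool :=
  all (fun i => ~~ f (nth 0 s i) (nth 0 s (i.+1 %% 5))%N) (iota 0 5).

Definition pentagon_positions (s : seq nat) : seq nat :=
  [seq position 5 (nth 0 s i) (nth 0 s (i.+1 %% 5))%N | i <- iota 0 5].

Definition triple_positions5 :=
  Eval vm_compute in [seq triple_positions 5 t | t <- triples 5].

Lemma triple_positions5E : triple_positions5 = [seq triple_positions 5 t | t <- triples 5].
Proof. by vm_compute. Qed.

Definition pentagon_positions5 :=
  Eval vm_compute in [seq pentagon_positions s | s <- permutations (iota 0 5)].

Lemma pentagon_positions5E :
  pentagon_positions5 = [seq pentagon_positions s | s <- permutations (iota 0 5)].
Proof. by vm_compute. Qed.

Lemma pentagon_check : all_bitseqs 10 (fun s =>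
  if lazy_has (constant_at s) triple_positions5 then true
  else lazy_has (all (fun i => ~~ nth false s i)) pentagon_positions5).
Proof. by vm_compute. Qed.

(** A colouring of [K_5] without monochromatic triangle splits it into a red and a blue pentagon.
    The blue one is kept because it is [l] that will be at least 5, whereas [k] may be 3. *)
Lemma ramsey_5_or_pentagon (e : nat -> nat -> bool) : (forall x y, e x y = e y x) ->
  (exists x y z, [/\ (x < 5)%N, (y < 5)%N & (z < 5)%N] /\
     [/\ x != y, z != x & z != y] /\ (e x z = e x y /\ e y z = e x y)) \/
  (exists s, [/\ size s = 5%N, uniq s, all (fun x => x < 5)%N s & pentagon e s]).
Proof.
move=> sym_e.
have := all_bitseqsP pentagon_check (erefl : size (tabulate 5 e) = 10%N).
rewrite triple_positions5E pentagon_positions5E.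
rewrite lazy_hasE; case: hasP => [[p /mapP[t t_in ->]] /(constant_atP sym_e t_in)|_].
  by case=> [lt5 [ne eqs]] _; left; exists t.1.1, t.1.2, t.2.
rewrite lazy_hasE => /hasP[p /mapP[s]].
rewrite mem_permutations => s_perm -> pent; right; exists s.
have sz : size s = 5%N by rewrite (perm_size s_perm).
have us : uniq s by rewrite (perm_uniq s_perm) iota_uniq.
have s5 : all (fun x => x < 5)%N s by rewrite (perm_all _ s_perm).
split=> //; apply/allP => i i5.
have i_lt : (i < 5)%N by rewrite mem_iota in i5.
have := allP pent (position 5 (nth 0 s i) (nth 0 s (i.+1 %% 5)))%N (map_f _ i5).
rewrite nth_tabulate //.
- by apply: (allP s5); rewrite mem_nth // sz.
- by apply: (allP s5); rewrite mem_nth // sz ltn_mod.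
- by rewrite nth_uniq ?sz ?ltn_mod //; move: i i_lt {i5}; do 5!case=> //.
Qed.

(** * Dense graphs *)

Section ColouredBlowup.
Variables (n q K : nat) (G : graph n) (c : colouring n).
Variables (F : {ffun 'I_q.+1 * 'I_K.+1 -> 'I_n}) (chi : 'I_q.+1 -> 'I_q.+1 -> bool).
Hypothesis FI : injective F.
Hypothesis chiP : forall i j a b, i != j ->
  adj G (F (i, a)) (F (j, b)) /\ Defs.col c (F (i, a)) (F (j, b)) = chi i j.

Definition part (i : 'I_q.+1) : {set 'I_n} := [set F (i, a) | a : 'I_K.+1].

Lemma card_part i : #|part i| = K.+1.
Proof. by rewrite card_imset ?card_ord // => a b /FI[]. Qed.

Lemma mono_blowup i j a b : i != j -> mono G c (chi i j) (F (i, a)) (F (j, b)).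
Proof. by move=> ij; have [adj_ij col_ij] := chiP a b ij; rewrite /mono adj_ij col_ij eqxx. Qed.

Lemma chi_sym i j : i != j -> chi i j = chi j i.
Proof.
move=> ij; have := mono_blowup ord0 ord0 ij; rewrite monoC /mono => /andP[_ /eqP <-].
by rewrite eq_sym in ij; have [_ ->] := chiP ord0 ord0 ij.
Qed.

Lemma blowup_even_cycle i j m : i != j -> ~~ odd m -> (3 <= m <= K)%N ->
  has_mono_cycle G c (chi i j) m.
Proof.
move=> ij evm /andP[m3 mK].
have mK2 : (m./2 <= K.+1)%N by lia.
apply: (@even_cycle _ _ _ _ _ (part i) (part j)); rewrite ?card_part //.
by move=> _ _ /imsetP[a _ ->] /imsetP[a' _ ->]; apply: mono_blowup.
Qed.

Lemma blowup_odd_cycle x y z m : x != y -> x != z -> y != z ->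
    chi x z = chi x y -> chi y z = chi x y -> odd m -> (3 <= m <= K)%N ->
  has_mono_cycle G c (chi x y) m.
Proof.
move=> xy xz yz chi_xz chi_yz oddm /andP[m3 mK].
have mK2 : (m./2 < K.+1)%N by lia.
apply: (@odd_cycle _ _ _ _ _ (part x :|: part y) (part z) (F (x, ord0)) (F (y, ord0)));
  rewrite ?card_part //.
- by apply: leq_trans mK2 _; rewrite -(card_part x) subset_leq_card ?subsetUl.
- exact: ltnW.
- by apply/setUP; left; apply: imset_f.
- by apply/setUP; right; apply: imset_f.
- exact: mono_blowup.
- move=> p _ /setUP[] /imsetP[a _ ->] /imsetP[a' _ ->].
    by rewrite -chi_xz; apply: mono_blowup.
  by rewrite -chi_yz; apply: mono_blowup.
Qed.

Definition chi_nat (x y : nat) : bool :=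
  (inord x == inord y :> 'I_q.+1) || chi (inord x) (inord y).

Lemma chi_nat_sym x y : chi_nat x y = chi_nat y x.
Proof.
rewrite /chi_nat eq_sym; have [//|/= xy] := eqVneq (inord y : 'I_q.+1) (inord x).
by rewrite chi_sym // eq_sym.
Qed.

Lemma inord_neq x y : (x < q.+1)%N -> (y < q.+1)%N -> x != y ->
  inord x != inord y :> 'I_q.+1.
Proof. by move=> xq yq; apply: contraNneq => /(congr1 val) /=; rewrite !inordK // => ->. Qed.

Lemma chi_natE x y : (x < q.+1)%N -> (y < q.+1)%N -> x != y ->
  chi_nat x y = chi (inord x) (inord y).
Proof. by move=> xq yq xy; rewrite /chi_nat (negPf (inord_neq xq yq xy)). Qed.

Lemma blowup_triple x y z m :
    [/\ (x < q.+1)%N, (y < q.+1)%N & (z < q.+1)%N] -> [/\ x != y, z != x & z != y] ->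
    chi_nat x z = chi_nat x y /\ chi_nat y z = chi_nat x y ->
    odd m -> (3 <= m <= K)%N ->
  has_mono_cycle G c (chi_nat x y) m.
Proof.
move=> [xq yq zq] [xy zx zy] [exz eyz] oddm mK.
rewrite eq_sym in zx; rewrite eq_sym in zy.
rewrite chi_natE //; apply: (@blowup_odd_cycle _ _ (inord z)); rewrite ?inord_neq //.
  by rewrite -!chi_natE.
by rewrite -!chi_natE.
Qed.

Lemma blowup_pentagon s m : size s = 5%N -> uniq s -> all (fun x => x < q.+1)%N s ->
    pentagon chi_nat s -> odd m -> (5 <= m <= K)%N ->
  has_mono_cycle G c false m.
Proof.
move=> sz us sq pent oddm /andP[m5 mK].
(* Walk along the pentagon, then back and forth on its fourth edge. *)
pose w i := if (i < 3)%N then i else if odd i then 3%N else 4%N.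
have w5 i : (w i < 5)%N by rewrite /w; case: ifP => [i3|_]; [rewrite (ltn_trans i3)|case: odd].
have wE i : (3 <= i)%N -> w i = if odd i then 3%N else 4%N by rewrite /w leqNgt => /negPf ->.
pose W i : 'I_q.+1 := inord (nth 0%N s (w i)).
have edge i j a b : (w j = (w i).+1 %% 5)%N -> mono G c false (F (W i, a)) (F (W j, b)).
  move=> wj; have sw x : (nth 0%N s (w x) < q.+1)%N.
    by apply: (allP sq); rewrite mem_nth // sz.
  have ij : nth 0%N s (w i) != nth 0%N s (w j).
    by rewrite nth_uniq ?sz // wj; case: (w i) (w5 i) => [|[|[|[|[|]]]]].
  have := allP pent (w i); rewrite mem_iota w5 -wj => /(_ isT).
  rewrite chi_natE // => /negPf <-; apply: mono_blowup; exact: inord_neq.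
apply: (@walk_cycle _ _ _ _ _ _ _ F W) => //.
- by apply/andP; split; lia.
- move=> i im a a'; have [i3|i3] := ltnP i 3.
    by apply: edge; case: i i3 {im} => [|[|[|]]].
  have [oi|/negPf ei] := boolP (odd i).
    by apply: edge; rewrite !wE ?(leq_trans i3) //= oi.
  by rewrite monoC; apply: edge; rewrite !wE ?(leq_trans i3) //= ei.
- move=> a a'; apply: edge; rewrite [w m.-1]wE; last by lia.
  by case: m oddm {m5 mK} => //= m /negPf ->.
Qed.

End ColouredBlowup.

Lemma threshold_zero_even_even (R : realType) (k l : nat) (d : R) : (3 <= k)%N -> (3 <= l)%N ->
  ~~ odd k -> ~~ odd l -> 0 < d -> threshold_zero k l d.
Proof.
move=> k3 l3 ek el d0.
have [|N HN] := @coloured_blowup R 1 d 'I_(k + l).+1 ord0 isT d0.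
  by rewrite invr1 subrr.
exists N => n leN G dG; apply/forallP => c.
have [F FI [chi chiP]] := HN n G c leN dG.
have := @blowup_even_cycle _ _ _ _ _ _ _ FI chiP ord0 ord_max.
by case: (chi _ _) => H; apply/orP; [left|right]; apply: H => //; lia.
Qed.

(** A single blue edge of the triangle pattern yields the even cycle; otherwise the whole triangle
    is red and yields the odd one. *)
Lemma threshold_zero_odd_even (R : realType) (k l : nat) (d : R) : (3 <= k)%N -> (3 <= l)%N ->
  odd k -> ~~ odd l -> 1 / 2 < d -> threshold_zero k l d.
Proof.
move=> k3 l3 ok el d2; have d0 : 0 < d by lra.
have [|N HN] := @coloured_blowup R 2 d 'I_(k + l).+1 ord0 isT d0; first by lra.
exists N => n leN G dG; apply/forallP => c.
have [F FI [chi chiP]] := HN n G c leN dG.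
have [/existsP[i /existsP[j /andP[ij]]]|] := boolP [exists i, exists j, (i != j) && ~~ chi i j].
  move=> /negPf chi_ij; apply/orP; right; rewrite -chi_ij.
  by apply: (blowup_even_cycle FI chiP); rewrite ?ij //; lia.
rewrite negb_exists => /forallP all_red; apply/orP; left.
have red i j : i != j -> chi i j = true.
  move=> ij; have := all_red i; rewrite negb_exists => /forallP/(_ j).
  by rewrite ij negbK.
rewrite -(red ord0 ord_max) //.
by apply: (@blowup_odd_cycle _ _ _ _ _ _ _ FI chiP _ _ (inord 1));
  rewrite ?red // -?val_eqE /= ?inordK //; lia.
Qed.

Lemma threshold_zero_odd_odd (R : realType) (k l : nat) (d : R) : (3 <= k)%N -> (5 <= l)%N ->
  odd k -> odd l -> 3 / 4 < d -> threshold_zero k l d.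
Proof.
move=> k3 l5 ok ol d2; have d0 : 0 < d by lra.
have [|N HN] := @coloured_blowup R 4 d 'I_(k + l).+1 ord0 isT d0; first by lra.
exists N => n leN G dG; apply/forallP => c.
have [F FI [chi chiP]] := HN n G c leN dG.
have [[x [y [z [lt5 [ne eqs]]]]]|[s [sz us s5 pent]]] :=
    ramsey_5_or_pentagon (chi_nat_sym chiP); last first.
  by apply/orP; right; apply: (blowup_pentagon FI chiP sz us s5 pent) => //; lia.
have := blowup_triple FI chiP lt5 ne eqs.
by case: (chi_nat _ _ _) => H; apply/orP; [left|right]; apply: H => //; lia.
Qed.

Lemma threshold_zero_triangles (R : realType) (d : R) : 4 / 5 < d -> threshold_zero 3 3 d.
Proof.
move=> d2; have d0 : 0 < d by lra.
have [|N HN] := @coloured_blowup R 5 d 'I_4 ord0 isT d0; first by lra.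
exists N => n leN G dG; apply/forallP => c.
have [F FI [chi chiP]] := HN n G c leN dG.
have [x [y [z [lt6 [[xy zx zy] eqs]]]]] := ramsey_6_crossing (chi_nat_sym chiP).
have ne : [/\ x != y, z != x & z != y].
  by split=> //; [apply: contraNneq zx => ->|apply: contraNneq zy => ->].
have := blowup_triple FI chiP lt6 ne eqs.
by case: (chi_nat _ _ _) => H; apply/orP; [left|right]; apply: H.
Qed.

(** * Colourings of multipartite graphs *)

Section SuccessorEdges.
Variables (D : finType) (next : D -> D).
Hypothesis next_neq : forall s, next s != s.
Hypothesis next2_neq : forall s, next (next s) != s.

(** Edges of a disjoint union of cycles, indexed by their initial vertices, so that each edge owns
    exactly one slot. *)
Definition successor_edge (s : D) : D * D := (s, next s).

Lemma successor_edge_loopless s : (successor_edge s).1 != (successor_edge s).2.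
Proof. by rewrite eq_sym next_neq. Qed.

Lemma successor_edge_simple s t :
  successor_edge s = successor_edge t \/
    successor_edge s = ((successor_edge t).2, (successor_edge t).1) -> s = t.
Proof.
case=> [[]|[/= -> E]] //.
by have := next2_neq t; rewrite E eqxx.
Qed.

End SuccessorEdges.

Lemma ordS_val m (i : 'I_m) : ordS i = (if (i.+1 == m)%N then 0 else i.+1)%N :> nat.
Proof.
rewrite /=; case: eqP => [->|]; first by rewrite modnn.
by move=> /eqP im; rewrite modn_small // ltn_neqAle im ltn_ord.
Qed.

Lemma ordS_neq m (i : 'I_m) : (1 < m)%N -> ordS i != i.
Proof.
move=> m1; apply/eqP => /(congr1 (@nat_of_ord m)); rewrite ordS_val.
by have := ltn_ord i; case: ifP; lia.
Qed.

Lemma ordS2_neq m (i : 'I_m) : (2 < m)%N -> ordS (ordS i) != i.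
Proof.
move=> m2; apply/eqP => /(congr1 (@nat_of_ord m)); rewrite !ordS_val.
by have := ltn_ord i; do 2!case: ifP; lia.
Qed.

(** First moment: at most [n^l] injections, each present with probability [p^l]. *)
Lemma gnp_cycle_le (R : realType) (n l : nat) (p : R) : (3 <= l)%N -> 0 <= p <= 1 ->
  gnp_prob p (fun S : graph n => [exists v : {ffun 'I_l -> 'I_n}, injectiveb v &&
     [forall i, adj S (v i) (v (ordS i))]]) <= (n%:R * p) ^+ l.
Proof.
move=> l3 p01; have p0 : 0 <= p by case/andP: p01.
pose e := successor_edge (@ordS l).
have loopless : forall i, (e i).1 != (e i).2.
  by apply: successor_edge_loopless => i; apply: ordS_neq; apply: ltnW.
have simple : forall i j, e i = e j \/ e i = ((e j).2, (e j).1) -> i = j.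
  by apply: successor_edge_simple => i; apply: ordS2_neq.
apply: le_trans (_ : gnp_prob p (fun S => [exists (v : {ffun 'I_l -> 'I_n} | injectiveb v),
    edge_image e v \subset S]) <= _).
  apply: gnp_mono => // S sS /existsP[v /andP[vI /forallP adjS]].
  apply/existsP; exists v; rewrite vI; apply/subsetP => _ /imsetP[i _ ->].
  by have := adjS i; rewrite adj_upair // => /andP[].
apply: le_trans (gnp_exists p01 _ _) _.
have -> : (n%:R * p) ^+ l = #|{ffun 'I_l -> 'I_n}|%:R * p ^+ l.
  by rewrite card_ffun !card_ord natrX exprMn.
rewrite mulr_natl -sumr_const big_mkcond; apply: ler_sum => v _.
case: ifP => [/injectiveP vI|_]; last exact: exprn_ge0.
by rewrite gnp_sub ?edge_image_sub // card_edge_image // card_ord.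
Qed.

Lemma gnp_nonempty_le (R : realType) (n : nat) (p : R) : 0 <= p <= 1 ->
  gnp_prob p (fun S : graph n => S != set0) <= n%:R ^+ 2 * p.
Proof.
move=> p01; have p0 : 0 <= p by case/andP: p01.
apply: le_trans (_ : gnp_prob p (fun S =>
    [exists (e | e \in upairs n), [set e] \subset S]) <= _).
  apply: gnp_mono => // S sS /set0Pn[e eS]; apply/existsP; exists e.
  by rewrite sub1set eS (subsetP sS).
apply: le_trans (gnp_exists p01 _ _) _.
rewrite (eq_bigr (fun=> p)) => [|e eU]; last first.
  by rewrite gnp_sub ?sub1set // cards1 expr1.
rewrite sumr_const -[leLHS]mulr_natl ler_wpM2r // -natrX ler_nat.
by apply: leq_trans (max_card _) _; rewrite card_prod card_ord.
Qed.

Lemma alternating_even m (g : 'I_m -> bool) : (0 < m)%N ->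
  (forall i, g (ordS i) = ~~ g i) -> ~~ odd m.
Proof.
case: m g => // m g _ alt.
have gE i (im : (i < m.+1)%N) : g (Ordinal im) = g ord0 (+) odd i.
  elim: i im => [|i IH] im; first by rewrite addbF; congr g; apply/val_inj.
  rewrite /= addbN -(IH (ltnW im)) -alt.
  by congr g; apply/val_inj; rewrite /= modn_small.
have := alt ord_max; rewrite (_ : ordS _ = ord0); last first.
  by apply/val_inj; rewrite /= modnn.
rewrite (_ : ord_max = Ordinal (ltnSn m)); last exact/val_inj.
by rewrite gE /=; case: (g ord0); case: (odd m).
Qed.

Definition multipartite (r n : nat) : graph n := [set e : 'I_n * 'I_n | (e.1 %% r != e.2 %% r)%N].

Lemma adj_multipartite r n (x y : 'I_n) :
  adj (multipartite r n) x y = (x %% r != y %% r)%N.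
Proof.
rewrite /adj !inE /= [(y %% r == _)%N]eq_sym orbb andb_idl //.
by apply: contraNneq => ->.
Qed.

(* A pair [x < y] in the same part and [j < r] give the pair [x + j < y]. *)
Lemma same_part_pairs (r n : nat) : (0 < r)%N ->
  (r * #|[set e in upairs n | (e.1 %% r == e.2 %% r)%N]| <= #|upairs n|)%N.
Proof.
case: n => [|n] r0.
  by rewrite (_ : [set e in _ | _] = set0) ?cards0 ?muln0 //; apply/setP => -[[]].
set B := [set e in _ | _].
have lt_shift x y j : ((x, y), j) \in setX B [set: 'I_r] -> (x + j < y)%N.
  rewrite !inE /= => /andP[/andP[xy /eqP exy] _]; have jr := ltn_ord j.
  have := divn_eq x r; have := divn_eq y r; rewrite exy => yE xE.
  have : (x %/ r < y %/ r)%N by rewrite ltnNge; apply/negP => le; nia.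
  by nia.
pose f (t : ('I_n.+1 * 'I_n.+1) * 'I_r) : 'I_n.+1 * 'I_n.+1 := (inord (t.1.1 + t.2), t.1.2).
have inB x y (j : 'I_r) : ((x, y), j) \in setX B [set: 'I_r] ->
    (inord (x + j) : 'I_n.+1) = (x + j)%N :> nat.
  by move=> /lt_shift H; rewrite inordK // (ltn_trans H).
rewrite -[r in (r * _)%N]card_ord -cardsT mulnC -cardsX.
rewrite -(card_in_imset (f := f)) => [|[[x y] j] [[x' y'] j'] tB t'B /=].
  apply/subset_leq_card/subsetP => _ /imsetP[[[x y] j] tB ->].
  by rewrite inE /= (inB x y) // (lt_shift x y).
rewrite /f /= => -[/(congr1 val) /=]; rewrite (inB x y) // (inB x' y') // => E Ey.
move: tB t'B; rewrite -{}Ey !inE /= !andbT => /andP[_ /eqP xy] /andP[_ /eqP x'y].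
have jr := ltn_ord j; have jr' := ltn_ord j'.
have := divn_eq x r; have := divn_eq x' r; rewrite xy x'y => xE' xE.
have xx' : x = x' :> nat.
  have : (x %/ r = x' %/ r)%N.
    rewrite -[LHS]addn0 -(divn_small jr) -divnMDl // -[RHS]addn0 -(divn_small jr') -divnMDl //.
    by congr (_ %/ _)%N; lia.
  by lia.
by rewrite (val_inj xx') (_ : j = j') //; apply/val_inj; rewrite /=; lia.
Qed.

(** The bound carries no error term, so the critical densities 1/2, 3/4 and 4/5 are themselves
    attained by the extremal graphs. *)
Lemma density_multipartite (R : realType) (r n : nat) : (0 < r)%N -> (1 < n)%N ->
  1 - r%:R^-1 <= density (multipartite r n) :> R.
Proof.
move=> r0 n1.
have U2 : (2 * #|upairs n| = n * n.-1)%N.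
  have := @card_pairs_in n setT; rewrite cardsT card_ord => ->; congr (2 * _)%N.
  by apply: eq_card => e; rewrite !inE !andbT.
have Ubin : #|upairs n| = 'C(n, 2) by rewrite bin2 -U2 mul2n doubleK.
have b0 : 0 < ('C(n, 2))%:R :> R by rewrite ltr0n bin_gt0.
rewrite /density ler_pdivlMr // -Ubin.
have := same_part_pairs n r0; set B := [set e in _ | _] => rB.
have E : (nedges (multipartite r n) + #|B| = #|upairs n|)%N.
  rewrite /nedges -(cardsID [set e : 'I_n * 'I_n | (e.1 %% r != e.2 %% r)%N] (upairs n)).
  congr (_ + _)%N; apply: eq_card => e; rewrite !inE ?adj_multipartite //.
  by rewrite negbK andbC.
have r0R : 0 < r%:R :> R by rewrite ltr0n.
have EB : (nedges (multipartite r n))%:R = #|upairs n|%:R - #|B|%:R :> R.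
  by rewrite -E natrD addrK.
rewrite EB mulrBl mul1r lerD2l lerN2 ler_pdivlMl // -natrM ler_nat.
exact: rB.
Qed.

Lemma dense_multipartite (R : realType) (r : nat) (d : R) : (0 < r)%N ->
  d <= 1 - r%:R^-1 -> dense_seq d (multipartite r).
Proof.
by move=> r0 dr; exists 2%N => n n2; apply: le_trans dr (density_multipartite _ _ _).
Qed.

Definition residue_colouring (r n : nat) (gamma : nat -> nat -> bool) : colouring n :=
  [ffun e : 'I_n * 'I_n => gamma (e.1 %% r)%N (e.2 %% r)%N].

Lemma col_residue r n gamma (x y : 'I_n) : (forall a b, gamma a b = gamma b a) ->
  Defs.col (residue_colouring r n gamma) x y = gamma (x %% r)%N (y %% r)%N.
Proof. by move=> sym; rewrite /Defs.col; case: ifP; rewrite ffunE. Qed.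

Lemma no_odd_mono_cycle n (G : graph n) (c : colouring n) (b : bool) (m : nat)
    (g : 'I_n -> bool) : odd m ->
  (forall x y, adj G x y -> Defs.col c x y = b -> g y = ~~ g x) ->
  ~~ has_mono_cycle G c b m.
Proof.
move=> oddm alt; apply/negP => /existsP[v /andP[_ /forallP vP]].
have m0 : (0 < m)%N by case: (m) oddm.
have := @alternating_even m (fun i => g (v i)) m0; rewrite oddm => /(_ _)/negP; apply => // i; have /andP[adj_i /eqP col_i] := vP i.
exact: alt adj_i col_i.
Qed.

(** Red pairs are those across the two parts, so red is bipartite whatever [S] is; a blue edge lies
    inside a part and therefore belongs to [S]. *)
Lemma not_ramsey_bipartite n (S : graph n) (k l : nat) : odd k ->
    ~~ [exists v : {ffun 'I_l -> 'I_n}, injectiveb v &&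
          [forall i, adj S (v i) (v (ordS i))]] ->
  ~~ cycle_ramsey (union_graph (multipartite 2 n) S) k l.
Proof.
move=> ok noS; pose gamma (a b : nat) := a != b.
have sym a b : gamma a b = gamma b a by rewrite /gamma eq_sym.
apply/negP => /forallP/(_ (residue_colouring 2 n gamma))/orP[|].
  apply/negP; apply: (@no_odd_mono_cycle _ _ _ _ _ (fun x => odd x)) => // x y _.
  by rewrite col_residue // /gamma !modn2; case: (odd x); case: (odd y).
case/existsP => v /andP[vI /forallP vP]; move/negP: noS; apply; apply/existsP; exists v.
rewrite vI; apply/forallP => i; have /andP[] := vP i.
rewrite col_residue // => + /eqP/negbFE/eqP E.
by rewrite /adj !inE /= E eqxx /= => /andP[-> /orP[]->]; rewrite ?orbT.
Qed.

(** Red joins the residues 0, 1 to 2, 3, and blue joins 0 to 1 and 2 to 3. Both colours are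
    bipartite: half the residue separates red ends, its parity blue ends. *)
Lemma not_ramsey_4partite n (k l : nat) : odd k -> odd l ->
  ~~ cycle_ramsey (multipartite 4 n) k l.
Proof.
move=> ok ol; pose gamma (a b : nat) := odd a./2 != odd b./2.
have sym a b : gamma a b = gamma b a by rewrite /gamma eq_sym.
apply/negP => /forallP/(_ (residue_colouring 4 n gamma))/orP[|]; apply/negP.
  apply: (@no_odd_mono_cycle _ _ _ _ _ (fun x => odd (x %% 4)./2)) => // x y _.
  by rewrite col_residue // /gamma; case: (odd _); case: (odd _).
apply: (@no_odd_mono_cycle _ _ _ _ _ (fun x => odd (x %% 4))) => // x y.
rewrite adj_multipartite col_residue // /gamma.
move: (x %% 4)%N (y %% 4)%N (ltn_pmod x (isT : 0 < 4)%N) (ltn_pmod y (isT : 0 < 4)%N).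
by do 5![case=> //]; do 5![case=> //].
Qed.

(** The residues carry the pentagon colouring of [K_5], and the vertices of a triangle have three
    different residues. *)
Lemma not_ramsey_5partite n : ~~ cycle_ramsey (multipartite 5 n) 3 3.
Proof.
pose gamma (a b : nat) := (((a + 1) %% 5 == b) || ((b + 1) %% 5 == a))%N.
have sym a b : gamma a b = gamma b a by rewrite /gamma orbC.
have no_tri b : ~~ has_mono_cycle (multipartite 5 n) (residue_colouring 5 n gamma) b 3.
  apply/negP => /existsP[v /andP[_ /forallP vP]].
  have := vP (inord 2); have := vP (inord 1); have := vP (inord 0); clear vP.
  rewrite !adj_multipartite !col_residue //.
  have [-> -> ->] : [/\ ordS (inord 0 : 'I_3) = inord 1, ordS (inord 1 : 'I_3) = inord 2
      & ordS (inord 2 : 'I_3) = inord 0] by split; apply/val_inj; rewrite /= !inordK.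
  have lt5 x := ltn_pmod (v (inord x : 'I_3)) (isT : 0 < 5)%N.
  move: (lt5 0%N) (lt5 1%N) (lt5 2%N).
  move: (v (inord 0) %% 5)%N (v (inord 1) %% 5)%N (v (inord 2) %% 5)%N => x y z.
  by rewrite /gamma; case: b; case: x => [|[|[|[|[|x]]]]] //;
    case: y => [|[|[|[|[|y]]]]] //; case: z => [|[|[|[|[|z]]]]].
by apply/negP => /forallP/(_ (residue_colouring 5 n gamma)); rewrite !(negPf (no_tri _)).
Qed.

Lemma below_inv_n (R : realType) (k l : nat) (d : R) (p : nat -> R) :
    odd k -> (3 <= l)%N -> d <= 1 / 2 -> is_prob_seq p -> little_o p inv_n ->
  exists G : forall n, graph n, dense_seq d G /\
    tends_to_one (fun n => gnp_prob (p n)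
                            (fun S => ~~ cycle_ramsey (union_graph (G n) S) k l)).
Proof.
move=> ok l3 d2 p01 small; exists (multipartite 2); split.
  by apply: dense_multipartite => //; lra.
(* As [x <= 1], the power [(n p)^l] is at most [n p], hence at most [eps]. *)
move=> eps eps0; pose x : R := Num.min 1 eps.
have x0 : 0 < x by rewrite lt_min ltr01.
have [N HN] := small x x0; exists N.+1 => n leN.
have n0 : 0 < n%:R :> R by rewrite ltr0n (leq_trans _ leN).
have pn0 : 0 <= p n by case/andP: (p01 n).
apply: gnp_prob_lb => //.
apply: le_trans (gnp_mono (p01 n) _) _.
  move=> S _; rewrite negbK; apply: contraTT; exact: not_ramsey_bipartite.
apply: le_trans (gnp_cycle_le _ l3 (p01 n)) _.
have np : n%:R * p n <= x.
  have := HN n (ltnW leN); rewrite /inv_n -(ler_pM2l n0) mulrCA divff ?gt_eqF //.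
  by rewrite mulr1.
apply: le_trans (_ : x <= _); last by rewrite ge_min lexx orbT.
apply: le_trans (np); rewrite -[leRHS]expr1; apply: ler_wiXn2l.
- by rewrite mulr_ge0.
- by apply: le_trans np _; rewrite ge_min lexx.
- exact: leq_trans l3.
Qed.

Lemma below_inv_n2 (R : realType) (k l r : nat) (d : R) (p : nat -> R) :
    (0 < r)%N -> d <= 1 - r%:R^-1 ->
    (forall n, ~~ cycle_ramsey (multipartite r n) k l) ->
    is_prob_seq p -> little_o p inv_n2 ->
  exists G : forall n, graph n, dense_seq d G /\
    tends_to_one (fun n => gnp_prob (p n)
                            (fun S => ~~ cycle_ramsey (union_graph (G n) S) k l)).
Proof.
move=> r0 dr not_ramsey p01 small; exists (multipartite r); split.
  exact: dense_multipartite.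
move=> eps eps0; have [N HN] := small eps eps0; exists N.+1 => n leN.
have n0 : 0 < n%:R ^+ 2 :> R by rewrite exprn_gt0 // ltr0n (leq_trans _ leN).
apply: gnp_prob_lb => //.
apply: le_trans (gnp_mono (p01 n) (Q := fun S => S != set0) _) _.
  move=> S _; rewrite negbK; apply: contraTneq => ->.
  by rewrite /union_graph setU0; apply: not_ramsey.
apply: le_trans (gnp_nonempty_le _ (p01 n)) _.
by have := HN n (ltnW leN); rewrite /inv_n2 -(ler_pM2l n0) mulrCA divff ?gt_eqF // mulr1.
Qed.

(** * Perturbation by p = omega(1/n) *)

Section CommonNeighbourhood.
Variables (n : nat) (G : graph n) (c : colouring n) (D : finType).
Variables (f : {ffun D -> 'I_n}) (W : {set 'I_n}) (pat : D -> bool).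
Hypothesis fI : injective f.
Hypothesis WP : forall w x, w \in W -> mono G c (pat x) w (f x).

Definition colour_class (b : bool) : {set D} := [set x | pat x == b].

Let Q b : {set 'I_n} := [set f x | x in colour_class b].

Let card_Q b : #|Q b| = #|colour_class b|.
Proof. exact: card_imset. Qed.

Let WQ b w y : w \in W -> y \in Q b -> mono G c b w y.
Proof. by move=> wW /imsetP[x]; rewrite inE => /eqP <- ->; apply: WP. Qed.

Lemma odd_cycle_slot_edge b m x y : odd m -> (3 <= m)%N -> pat x = b -> pat y = b ->
    mono G c b (f x) (f y) -> (m./2 < #|colour_class b|)%N -> (m./2 <= #|W|)%N ->
  has_mono_cycle G c b m.
Proof.
move=> oddm m3 px py fxy cb cW.
apply: (@odd_cycle _ _ _ _ _ (Q b) W (f x) (f y)); rewrite ?card_Q //.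
- by apply: imset_f; rewrite inE px.
- by apply: imset_f; rewrite inE py.
- by move=> p q pQ qW; rewrite monoC; apply: WQ.
Qed.

Lemma odd_cycle_nbhd_edge b m w w' : odd m -> (3 <= m)%N -> w \in W -> w' \in W ->
    mono G c b w w' -> (m./2 <= #|colour_class b|)%N -> (m./2 < #|W|)%N ->
  has_mono_cycle G c b m.
Proof.
move=> oddm m3 wW w'W ww' cb cW.
by apply: (@odd_cycle _ _ _ _ _ W (Q b) w w'); rewrite ?card_Q // => p q; apply: WQ.
Qed.

Lemma even_cycle_nbhd b m : ~~ odd m -> (3 <= m)%N ->
    (m./2 <= #|colour_class b|)%N -> (m./2 <= #|W|)%N ->
  has_mono_cycle G c b m.
Proof.
move=> evm m3 cb cW.
by apply: (@even_cycle _ _ _ _ _ W (Q b)); rewrite ?card_Q // => p q; apply: WQ.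
Qed.

Lemma card_colour_class b : (#|colour_class b| + #|colour_class (~~ b)| = #|D|)%N.
Proof.
rewrite -(cardC (mem (colour_class b))); congr (_ + _)%N; apply: eq_card => x.
by rewrite !inE; case: (pat x); case: b.
Qed.

End CommonNeighbourhood.

Section CycleFamily.
Variables (M k l : nat).

(** The vertices of [M] disjoint copies of an [l]-cycle together with a [k]-cycle. *)
Definition cycle_slot : predArgType := ('I_M * ('I_l + 'I_k))%type.

Definition next_slot (s : cycle_slot) : cycle_slot :=
  (s.1, match s.2 with inl x => inl (ordS x) | inr x => inr (ordS x) end).

Hypotheses (k3 : (3 <= k)%N) (l3 : (3 <= l)%N).

Lemma next_slot_neq s : next_slot s != s.
Proof.
by case: s => j [x|x]; rewrite /next_slot xpair_eqE eqxx /=;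
  apply: (ordS_neq x); apply: ltnW.
Qed.

Lemma next_slot_loopless s :
  (successor_edge next_slot s).1 != (successor_edge next_slot s).2.
Proof. exact: successor_edge_loopless next_slot_neq s. Qed.

Lemma next2_slot_neq s : next_slot (next_slot s) != s.
Proof.
by case: s => j [x|x]; rewrite /next_slot xpair_eqE eqxx /=;
  apply: (ordS2_neq x).
Qed.

Variables (n : nat) (G S : graph n) (c : colouring n).
Variables (f : {ffun cycle_slot -> 'I_n}) (W : {set 'I_n}) (pat : cycle_slot -> bool).
Hypotheses (fI : injective f) (sS : S \subset upairs n).
Hypothesis fS : edge_image (successor_edge next_slot) f \subset S.
Hypothesis WP : forall w x, w \in W -> mono (union_graph G S) c (pat x) w (f x).

Lemma adj_union x y : adj (union_graph G S) x y = adj G x y || adj S x y.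
Proof. by rewrite /adj !inE -andb_orr orbACA. Qed.

(** Fewer than [M] slots of the other colour leave one of the [M] cycles joined to [W] entirely in
    colour [b]. Either one of its edges has colour [b] and closes a cycle of length [mo] through
    [W], or the cycle itself is monochromatic in the other colour. *)
Lemma majority_cycle b mo m (slot : 'I_m -> 'I_l + 'I_k) : injective slot ->
    (forall j x, next_slot (j, slot x) = (j, slot (ordS x))) ->
    odd mo -> (3 <= mo)%N -> (#|colour_class pat (~~ b)| < M)%N ->
    (mo./2 < #|colour_class pat b|)%N -> (mo./2 <= #|W|)%N ->
  has_mono_cycle (union_graph G S) c b mo || has_mono_cycle (union_graph G S) c (~~ b) m.
Proof.
move=> slotI slot_next oddm m3 few many cW.
have [j all_b] : exists j, forall x, pat (j, slot x) = b.
  have [/forallP bad|] := boolP [forall j : 'I_M, exists x, pat (j, slot x) != b].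
    suff : (M <= #|colour_class pat (~~ b)|)%N by rewrite leqNgt few.
    have cM : #|[set: 'I_M]| = M by rewrite cardsT card_ord.
    rewrite -[X in (X <= _)%N]cM; apply: leq_trans (leq_imset_card fst _).
    apply/subset_leq_card/subsetP => j _; have /existsP[x px] := bad j.
    apply/imsetP; exists (j, slot x) => //; rewrite inE.
    by move: px; case: (pat _); case: (b).
  rewrite negb_forall => /existsP[j]; rewrite negb_exists => /forallP H.
  by exists j => x; apply/eqP; rewrite -[_ == _]negbK.
have edge x : adj (union_graph G S) (f (j, slot x)) (f (j, slot (ordS x))).
  rewrite adj_union; apply/orP; right; rewrite -slot_next.
  exact: (edge_image_adj next_slot_loopless (j, slot x) fI sS fS).
have [/existsP[x /eqP fx_b]|] :=
    boolP [exists x, Defs.col c (f (j, slot x)) (f (j, slot (ordS x))) == b].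
  rewrite (odd_cycle_slot_edge fI WP oddm m3 (all_b x) (all_b (ordS x))) //.
  by rewrite /mono edge fx_b eqxx.
rewrite negb_exists => /forallP not_b; apply/orP; right.
apply/existsP; exists [ffun x => f (j, slot x)]; apply/andP; split.
  by apply/injectiveP => x y; rewrite !ffunE => /fI[/slotI].
apply/forallP => x; rewrite !ffunE edge /=.
by have := not_b x; case: (Defs.col _ _ _); case: (b).
Qed.

Lemma cycle_family_ramsey : odd k -> M = (k + l)%N -> (k + l <= #|W|)%N ->
    (odd l -> spans_edge S W) ->
  has_mono_cycle (union_graph G S) c true k || has_mono_cycle (union_graph G S) c false l.
Proof.
move=> ok ME cW spanW.
have cD := card_colour_class pat true.
have MD : (M * (l + k) = (k + l) * (l + k))%N by rewrite ME.
rewrite card_prod card_ord card_sum !card_ord MD /= in cD.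
have hk : (k./2 < k)%N by lia.
have hl : (l./2 < l)%N by lia.
(* Fewer than [l <= M] blue slots leave a red majority; [l] or more suffice for every blue cycle
   through [W] used below. *)
have [few|many] := ltnP #|colour_class pat false| l.
  apply: (@majority_cycle true k l inl) => //; [exact: inl_inj| | |lia].
    by apply: leq_trans few _; rewrite ME leq_addl.
  have big : (k + l <= (k + l) * (l + k))%N by rewrite leq_pmulr // addn_gt0 (ltnW (ltnW l3)).
  apply: leq_trans hk _; rewrite -(leq_add2r #|colour_class pat false|) cD.
  by apply: leq_trans big; rewrite leq_add2l ltnW.
have [ol|el] := boolP (odd l); last first.
  by apply/orP; right; apply: (even_cycle_nbhd fI WP el) => //; lia.
have /existsP[w /existsP[w' /and3P[wW w'W ww']]] := spanW ol.
have ww'_mono : mono (union_graph G S) c (Defs.col c w w') w w'.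
  by rewrite /mono adj_union ww' orbT eqxx.
move: ww'_mono; case: (Defs.col c w w') => ww'_mono; last first.
  by apply/orP; right; apply: (odd_cycle_nbhd_edge fI WP ol l3 wW w'W ww'_mono); lia.
(* The random edge inside [W] is red. With at least [k] red slots it closes a red cycle; otherwise
   the majority argument applies with the colours exchanged and the [k]-cycles in place of the
   [l]-cycles. *)
have [few|many_red] := ltnP #|colour_class pat true| k; last first.
  by apply/orP; left; apply: (odd_cycle_nbhd_edge fI WP ok k3 wW w'W ww'_mono); lia.
rewrite orbC; apply: (@majority_cycle false l k inr) => //; [exact: inr_inj| | |lia].
  by apply: leq_trans few _; rewrite ME leq_addr.
by apply: leq_trans hl _.
Qed.

End CycleFamily.

(** Translates a linear size [n %/ t] into the pair count of [no_large_independent]; the factor 16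
    absorbs the rounding. *)
Lemma linear_pairs (t n : nat) : (0 < t)%N -> (2 * t <= n)%N ->
  (2 * (n * (n %/ (16 * t * t))) <= (n %/ t) * (n %/ t).-1)%N.
Proof.
move=> t0 tn; set y := (n %/ (16 * t * t))%N; set m := (n %/ t)%N.
have m2 : (2 <= m)%N by rewrite leq_divRL.
have ty : (16 * (t * y) <= m)%N.
  rewrite leq_divRL //; apply: leq_trans (leq_trunc_div n (16 * t * t)); rewrite -/y.
  by nia.
have ny : (n * y <= m.+1 * (t * y))%N.
  by rewrite mulnA leq_mul2r ltnW ?orbT // ltn_ceil.
move: ty ny; move: (t * y)%N (n * y)%N => z x ty ny.
have : (16 * (m.+1 * z) <= m.+1 * m)%N by rewrite mulnCA leq_mul2l ty orbT.
by move: m2 ny; case: m {ty} => // m'; rewrite succnK; nia.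
Qed.

Lemma above_inv_n (R : realType) (k l : nat) (d : R) (p : nat -> R) :
    odd k -> (3 <= k)%N -> (3 <= l)%N -> 0 < d -> is_prob_seq p ->
    little_omega p inv_n -> forall G : forall n, graph n, dense_seq d G ->
  tends_to_one (fun n => gnp_prob (p n)
                          (fun S => cycle_ramsey (union_graph (G n) S) k l)).
Proof.
move=> ok k3 l3 d0 p01 large G [N0 dG] eps eps0.
pose M := (k + l)%N; pose D : finType := cycle_slot M k l.
pose e : D -> D * D := successor_edge (@next_slot M k l).
have d20 : 0 < d / 2 by rewrite divr_gt0.
have eps2 : 0 < eps / 2 by rewrite divr_gt0.
have [N1 deg] : exists N : nat, forall n (G : graph n), (N <= n)%N -> d <= density G ->
    d / 2 * n%:R ^+ 2 <= \sum_w #|[set v | adj G v w]|%:R.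
  by apply: dense_degree_sum => //; lra.
have [a a0 [N2 nbr]] := @common_neighbours R D (d / 2) d20.
(* Pigeonhole over [2^|D|] patterns reduces a common neighbourhood of size [a * n] to at least
   [n / t] vertices. *)
have [t t0 le_t] : exists2 t : nat, (0 < t)%N & 2 ^+ #|D| / a <= t%:R.
  have [t le_t] := nat_large (2 ^+ #|D| / a); exists t.+1 => //.
  by apply: le_trans le_t _; rewrite ler_nat.
have [q qE] : exists q, q = (16 * t * t)%N by exists (16 * t * t)%N.
have q0 : (0 < q)%N by rewrite qE !muln_gt0 t0.
have [C C0 indep] := @no_large_independent_whp R q (eps / 2) q0 eps2.
have own1 (j : D) : #|[set s | id s == j]| = 1%N.
  by rewrite -(cards1 j); apply: eq_card => s; rewrite !inE.
have [kappa kappa0 embed] := @embedding_whp R D D e id 1 a (eps / 2)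
  (next_slot_loopless k3 l3) (successor_edge_simple (next2_slot_neq k3 l3))
  (fun s => or_introl erefl) own1 isT a0 eps2.
have kappaV : 0 < kappa^-1 by rewrite invr_gt0.
(* [C] serves the independent sets. With [b = 1] the embedding asks for [1/p <= kappa * n], that is
   [p * n >= 1/kappa]. *)
have [N3 p_large] := large (C + kappa^-1) (addr_gt0 C0 kappaV).
exists (N0 + N1 + N2 + N3 + q + t * (k + l) + 2 * t).+1 => n leN.
have [n0 nN0 nN1 nN2] : [/\ (0 < n)%N, (N0 <= n)%N, (N1 <= n)%N & (N2 <= n)%N].
  by clear -leN; split; lia.
have [nN3 nq nkl nt] : [/\ (N3 <= n)%N, (q <= n)%N, (t * (k + l) <= n)%N & (2 * t <= n)%N].
  by clear -leN; split; lia.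
have n0R : 0 < n%:R :> R by rewrite ltr0n.
have Cpn : C + kappa^-1 <= p n * n%:R.
  by rewrite -ler_pdivrMr //; apply: p_large.
have pn0 : 0 < p n.
  rewrite -(pmulr_lgt0 _ n0R); apply: lt_le_trans Cpn; exact: addr_gt0.
have p1 : p n <= 1 by case/andP: (p01 n).
pose nb (f : {ffun D -> 'I_n}) := [set w | [forall x, adj (G n) (f x) w]].
pose F := [set f : {ffun D -> 'I_n} | injectiveb f && (a * n%:R <= #|nb f|%:R)].
have cF : a * n%:R ^+ #|D| <= #|F|%:R.
  have := nbr 'I_n (adj (G n)); rewrite card_ord; apply => //.
  by apply: deg => //; apply: dG.
have FI : {in F, forall f : {ffun D -> 'I_n}, injective f}.
  by move=> f; rewrite inE => /andP[/injectiveP].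
have no_cycles := embed n (p n) (p n)^-1 F n0 _ _ (expr1 _) _ FI cF.
have no_indep := indep n (p n) _ (p01 n) _.
(* A failure means that no member of [F] has all its cycles in [S], or that some large set spans no
   random edge; each has probability at most [eps / 2]. *)
apply: gnp_prob_lb => //; rewrite [eps]splitr.
apply: le_trans (lerD (no_cycles _ _ _) (no_indep _ _)).
- apply: le_trans (gnp_union (p01 n) _ _); apply: gnp_mono => // S sS.
  apply: contraNT; rewrite negb_or negbK => /andP[].
  rewrite negb_forall => /existsP[f]; rewrite negb_imply negbK => /andP[fF fS] indepS.
  apply/forallP => c; have fI := FI _ fF.
  have := fF; rewrite inE => /andP[_ cW].
  pose pt w : {ffun D -> bool} := [ffun x => Defs.col c w (f x)].
  have pat0 : (0 < #|{: {ffun D -> bool}}|)%N by apply/card_gt0P; exists [ffun=> true].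
  have cW' : a * n%:R <= #|[set w | w \in nb f]|%:R.
    apply: le_trans cW _; rewrite ler_nat subset_leq_card //.
    by apply/subsetP => w; rewrite [in X in _ -> X]inE.
  have [pat] := pigeonhole_density pt pat0 cW'.
  set W := [set w | _] => card_W.
  have w0W : (n %/ t <= #|W|)%N.
    rewrite -(ler_nat R); apply: le_trans card_W.
    rewrite card_ffun card_bool natrX.
    have t0R : 0 < t%:R :> R by rewrite ltr0n.
    apply: le_trans (_ : n%:R / t%:R <= _).
      by rewrite ler_pdivlMr // -natrM ler_nat leq_trunc_div.
    rewrite ler_pdivrMr // mulrAC ler_pdivlMr ?exprn_gt0 //.
    have := le_t; rewrite ler_pdivrMr // => /(ler_wpM2l (ltW n0R)) /le_trans; apply.
    by rewrite [t%:R * a]mulrC mulrCA mulrA.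
  have WP w x : w \in W -> mono (union_graph (G n) S) c (pat x) w (f x).
    rewrite inE => /andP[]; rewrite inE => /forallP/(_ x) adj_w /eqP <-.
    by rewrite /mono ffunE eqxx andbT adjC adj_union adj_w.
  apply: (cycle_family_ramsey k3 l3 fI sS fS WP ok (erefl _)).
    by apply: leq_trans w0W; rewrite leq_divRL // mulnC.
  move=> _; have /forallP/(_ W)/implyP := indepS; apply.
  rewrite qE; apply: leq_trans (linear_pairs t0 nt) _.
  by rewrite leq_mul // -!subn1 leq_sub2r.
- by rewrite pn0.
- by rewrite invf_ge1.
- rewrite -(ler_pM2l pn0) divff ?gt_eqF // mulrCA -ler_pdivrMl // mulr1.
  by apply: le_trans Cpn; rewrite lerDr ltW.
- exact: nq.
- by apply: le_trans Cpn; rewrite lerDl ltW.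
Qed.

(** * Perturbation by p = omega(1/n^2) *)

Section Units.
Variable t : nat.

(** A unit is a random edge inside one of three parts, and each part holds [t] of them. Every edge
    owns both its slots, so [b = 2], as the threshold [1/n^2] demands. *)
Definition unit_slot : predArgType := ('I_3 * ('I_t * bool))%type.

Definition unit_edge (j : 'I_3 * 'I_t) : unit_slot * unit_slot :=
  ((j.1, (j.2, false)), (j.1, (j.2, true))).

Definition unit_of (s : unit_slot) : 'I_3 * 'I_t := (s.1, s.2.1).

Lemma unit_edge_loopless j : (unit_edge j).1 != (unit_edge j).2.
Proof. by rewrite /unit_edge !xpair_eqE /= !andbF. Qed.

Lemma unit_edge_simple i j :
  unit_edge i = unit_edge j \/ unit_edge i = ((unit_edge j).2, (unit_edge j).1) -> i = j.
Proof. by case: i j => [i a] [j b] [[-> ->]|[]]. Qed.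

Lemma unit_of_end s : s = (unit_edge (unit_of s)).1 \/ s = (unit_edge (unit_of s)).2.
Proof. by case: s => i [a []]; [right|left]. Qed.

Lemma card_unit_of j : #|[set s | unit_of s == j]| = 2%N.
Proof.
have -> : [set s | unit_of s == j] = [set (unit_edge j).1; (unit_edge j).2].
  apply/setP => -[i [a b]]; case: j => i' a'; rewrite !inE /unit_edge /unit_of !xpair_eqE /=.
  by case: b; rewrite ?andbT ?andbF ?orbF.
by rewrite cards2 unit_edge_loopless.
Qed.

Variables (n : nat) (G S : graph n) (c : colouring n) (f : {ffun unit_slot -> 'I_n}).
Hypotheses (fI : injective f) (sS : S \subset upairs n).
Hypothesis fS : edge_image unit_edge f \subset S.
Hypothesis fG : forall s s', s.1 != s'.1 -> adj G (f s) (f s').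

Definition unit_pattern (tau : {ffun 'I_3 -> 'I_t}) :
    {ffun ('I_3 * bool) * ('I_3 * bool) -> bool} :=
  [ffun uv => Defs.col c (f (uv.1.1, (tau uv.1.1, uv.1.2))) (f (uv.2.1, (tau uv.2.1, uv.2.2)))].

Variables (K : nat) (F : {ffun 'I_3 * 'I_K.+1 -> 'I_t}).
Variable chi : {ffun ('I_3 * bool) * ('I_3 * bool) -> bool}.
Hypotheses (FI : injective F) (Fchi : forall phi, unit_pattern (transversal F phi) = chi).

Let node (x : nat) : 'I_3 * bool := (inord x./2, odd x).
Let vtx (u : 'I_3 * bool) (a : 'I_K.+1) : 'I_n := f (u.1, (F (u.1, a), u.2)).
Let nodes u : {set 'I_n} := [set vtx u a | a : 'I_K.+1].

Let vtx_inj u : injective (vtx u).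
Proof. by move=> a a' /fI [/FI []]. Qed.

Let card_nodes u : #|nodes u| = K.+1.
Proof. by rewrite card_imset ?card_ord //; apply: vtx_inj. Qed.

(** Two vertices in the same part follow the pattern only if they come from the same unit, hence the
    condition [a = a']; in different parts a transversal through both units exists. *)
Let col_vtx u v a a' : (u.1 == v.1 -> a = a') ->
  Defs.col c (vtx u a) (vtx v a') = chi (u, v).
Proof.
move=> aa'; rewrite -(Fchi [ffun i => if i == u.1 then a else a']) !ffunE /= eqxx.
rewrite /vtx; case: (eqVneq v.1 u.1) => // uv; rewrite uv eqxx in aa' *.
by rewrite aa' // uv.
Qed.

Let mono_far u v a a' : u.1 != v.1 ->
  mono (union_graph G S) c (chi (u, v)) (vtx u a) (vtx v a').
Proof.
move=> uv; rewrite /mono adj_union fG //= col_vtx ?eqxx //.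
by rewrite (negPf uv).
Qed.

Let mono_near u v a : u != v -> mono (union_graph G S) c (chi (u, v)) (vtx u a) (vtx v a).
Proof.
move=> uv; have [E|/mono_far->//] := eqVneq u.1 v.1.
rewrite /mono col_vtx // eqxx andbT adj_union; apply/orP; right.
have adjS := edge_image_adj unit_edge_loopless (u.1, F (u.1, a)) fI sS fS.
move: uv E adjS; case: u v => i b [i' b'] /=; rewrite xpair_eqE => + E.
rewrite -{}E eqxx /vtx /=; case: b; case: b' => // _ adjS.
by rewrite adjC.
Qed.

(** Vertices [2 i] and [2 i + 1] of [K_6] are the ends of a unit in part [i]. For a crossing
    triangle the copies of [z] are joined to all copies of [x] and [y], and a single edge between
    copies of [x] and [y] is all that [odd_cycle] asks for. *)
Lemma unit_ramsey k l : odd k -> odd l -> (3 <= k <= K)%N -> (3 <= l <= K)%N ->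
  has_mono_cycle (union_graph G S) c true k || has_mono_cycle (union_graph G S) c false l.
Proof.
move=> ok ol kK lK.
have chi_sym x y : chi (node x, node y) = chi (node y, node x).
  by rewrite -(Fchi [ffun=> ord0]) !ffunE colC.
have [x [y [z [[x6 y6 z6] [[xy zx zy] [exz eyz]]]]]] :=
  ramsey_6_crossing chi_sym.
have col_neq i j : (i < 6)%N -> (j < 6)%N -> i./2 != j./2 -> (node j).1 != (node i).1.
  move=> i6 j6 ij; rewrite eq_sym; apply: contraNneq ij => /(congr1 val) /=.
  have h3 r : (r < 6)%N -> (r./2 < 3)%N by clear; lia.
  by rewrite !inordK ?h3 // => ->.
have node_xy : node x != node y.
  rewrite xpair_eqE; have [hxy|hxy] := eqVneq x./2 y./2.
    apply: contraNN xy => /andP[_ /eqP /= exy].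
    by rewrite -(odd_double_half x) -(odd_double_half y) hxy exy.
  by rewrite negb_and eq_sym (col_neq x y).
have main m : odd m -> (3 <= m <= K)%N ->
    has_mono_cycle (union_graph G S) c (chi (node x, node y)) m.
  move=> om /andP[m3 mK].
  apply: (@odd_cycle _ _ _ _ _ (nodes (node x) :|: nodes (node y)) (nodes (node z))
    (vtx (node x) ord0) (vtx (node y) ord0)) => //.
  - rewrite (@leq_trans #|nodes (node x)|) ?subset_leq_card ?subsetUl // card_nodes.
    by clear -mK; lia.
  - by rewrite card_nodes; clear -mK; lia.
  - by apply/setUP; left; apply: imset_f.
  - by apply/setUP; right; apply: imset_f.
  - exact: mono_near.
  - move=> p _ /setUP[] /imsetP[a _ ->] /imsetP[a' _ ->].
      by rewrite -exz; apply: mono_far; apply: col_neq.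
    by rewrite -eyz; apply: mono_far; apply: col_neq.
by case: (chi _) main => main; apply/orP; [left|right]; apply: main.
Qed.

End Units.

Lemma above_inv_n2 (R : realType) (k l : nat) (d : R) (p : nat -> R) :
    odd k -> odd l -> (3 <= k)%N -> (3 <= l)%N -> 1 / 2 < d -> is_prob_seq p ->
    little_omega p inv_n2 -> forall G : forall n, graph n, dense_seq d G ->
  tends_to_one (fun n => gnp_prob (p n)
                          (fun S => cycle_ramsey (union_graph (G n) S) k l)).
Proof.
move=> ok ol k3 l3 d2 p01 large G [N0 dG] eps eps0.
have d0 : 0 < d by lra.
pose pat : finType := {ffun ('I_3 * bool) * ('I_3 * bool) -> bool}.
have pat0 : (0 < #|pat|)%N by apply/card_gt0P; exists [ffun=> true].
(* Some pattern is shared by at least this proportion of the choices of one unit per part. *)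
have delta0 : 0 < (#|pat|%:R)^-1 :> R by rewrite invr_gt0 ltr0n.
(* The box argument runs over the unit indices, so [t] is a constant fixed before [n] and before the
   colouring. *)
have [t' box] := @box_exists R 'I_3 'I_(k + l).+1 ord0 _ delta0.
have [t t't t0] : exists2 t, (t' <= t)%N & (0 < t)%N by exists t'.+1.
have [|a a0 [N1 many]] := @many_blowups R 2 d ('I_t * bool)%type (Ordinal t0, true) isT d0.
  by lra.
have [kappa kappa0 embed] := @embedding_whp R (unit_slot t) ('I_3 * 'I_t)%type (@unit_edge t)
  (@unit_of t) 2 a eps (@unit_edge_loopless t) (@unit_edge_simple t) (@unit_of_end t)
  (@card_unit_of t) isT a0 eps0.
(* With [b = 2] the condition [q <= kappa * n] reads [p * n^2 >= kappa^-2]. *)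
have kV0 : 0 < kappa ^- 2 by rewrite invr_gt0 exprn_gt0.
have [N2 p_large] := large _ kV0.
exists (N0 + N1 + N2).+1 => n leN.
have [n0 nN0 nN1 nN2] : [/\ (0 < n)%N, (N0 <= n)%N, (N1 <= n)%N & (N2 <= n)%N].
  by clear -leN; split; lia.
have n0R : 0 < n%:R ^+ 2 :> R by rewrite exprn_gt0 // ltr0n.
have pn : kappa ^- 2 <= p n * n%:R ^+ 2 by rewrite -ler_pdivrMr //; apply: p_large.
have pn0 : 0 < p n by rewrite -(pmulr_lgt0 _ n0R); apply: lt_le_trans pn.
have p1 : p n <= 1 by case/andP: (p01 n).
pose q := Num.sqrt (p n)^-1.
have q2 : q ^+ 2 = (p n)^-1 by rewrite sqr_sqrtr // invr_ge0 ltW.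
have q0 : 0 <= q by apply: sqrtr_ge0.
pose blown (f : {ffun unit_slot t -> 'I_n}) :=
  [forall s, forall s', (s.1 != s'.1) ==> adj (G n) (f s) (f s')].
pose FF := [set f : {ffun unit_slot t -> 'I_n} | injectiveb f && blown f].
apply: gnp_prob_lb => //.
apply: le_trans (embed n (p n) q FF n0 _ _ q2 _ _ _).
- apply: gnp_mono => // S sS; apply: contraNT.
  rewrite negb_forall => /existsP[f]; rewrite negb_imply negbK => /andP[fF fS].
  move: fF; rewrite inE => /andP[/injectiveP fI /forallP blown_f].
  have fG s s' : s.1 != s'.1 -> adj (G n) (f s) (f s').
    by have /forallP/(_ s')/implyP := blown_f s.
  apply/forallP => c.
  have all_tau : 1 *+ #|{ffun 'I_3 -> 'I_t}| <=
      #|[set tau : {ffun 'I_3 -> 'I_t} | xpredT tau]|%:R :> R.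
    by rewrite ler_nat; apply/subset_leq_card/subsetP => tau _; rewrite inE.
  have [chi card_chi] := pigeonhole_density (unit_pattern c f) pat0 all_tau.
  have [||F FI Fchi] := box 'I_t (fun tau => unit_pattern c f tau == chi).
  - by rewrite card_ord.
  - by move: card_chi; rewrite card_ffun natrX mulrC.
  by apply: (unit_ramsey fI sS fS fG FI (fun phi => eqP (Fchi phi))) => //;
    clear -k3 l3; lia.
- by rewrite pn0.
- by rewrite -(ler_pXn2r (isT : 0 < 2)%N) ?nnegrE // expr1n q2 invf_ge1.
- have kn0 : 0 <= kappa * n%:R by rewrite mulr_ge0 // ltW.
  rewrite -(ler_pXn2r (isT : 0 < 2)%N) ?nnegrE // q2 exprMn.
  rewrite -(ler_pM2l pn0) divff ?gt_eqF // mulrCA -ler_pdivrMl ?exprn_gt0 // mulr1.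
  exact: pn.
- by move=> f; rewrite inE => /andP[/injectiveP].
- by apply: many => //; apply: dG.
Qed.

(** * The thresholds in all parity cases *)

Unset Implicit Arguments.

Theorem theorem1p9 (R : realType) (k l : nat) :
  (3 <= k)%N -> (3 <= l)%N ->
  (odd k && ~~ odd l) || ((odd k == odd l) && (k <= l)%N) ->
  exists d1 d2 : R, 0 <= d1 <= 1 /\ 0 <= d2 <= 1 /\
    (forall d : R, 0 < d < 1 ->
       (d <= d1 -> perturbed_threshold k l d inv_n) /\
       (d1 < d <= d2 -> perturbed_threshold k l d inv_n2) /\
       (d2 < d -> threshold_zero k l d)) /\
    (~~ odd k -> ~~ odd l -> d1 = 0 /\ d2 = 0) /\
    (odd k -> ~~ odd l -> d1 = 1/2 /\ d2 = 1/2) /\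
    (odd k -> l = 3%N -> d1 = 1/2 /\ d2 = 4/5) /\
    (odd k -> odd l -> (5 <= l)%N -> d1 = 1/2 /\ d2 = 3/4).
Proof.
move=> k3 l3.
have [ok|ek] := boolP (odd k); last first.
  (* For even [k] the parity hypothesis leaves only even [l]. Both cut-offs are 0, so every positive
     [d] falls into the last range. *)
  have [ol|el] := boolP (odd l) => //= _.
  exists 0, 0; split; first by rewrite lexx ler01.
  split; first by rewrite lexx ler01.
  split=> [d /andP[d0 d1]|]; last by do !split.
  split; first by move=> ?; lra.
  split; first by case/andP=> ? ?; lra.
  exact: threshold_zero_even_even.
have thr1 (d : R) : 0 < d -> d <= 1 / 2 -> perturbed_threshold k l d inv_n.
  move=> d0 d2; split=> [p p01 large G dG|p p01 small].
    exact: above_inv_n dG.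
  exact: below_inv_n.
have thr2 (r : nat) (d : R) : (0 < r)%N -> odd l -> 1 / 2 < d -> d <= 1 - r%:R^-1 ->
    (forall n, ~~ cycle_ramsey (multipartite r n) k l) -> perturbed_threshold k l d inv_n2.
  move=> r0 ol d2 dr nr; split=> [p p01 large G dG|p p01 small].
    exact: above_inv_n2 dG.
  exact: below_inv_n2 nr p01 small.
have [ol|el] /= := boolP (odd l); last first.
  (* Equal cut-offs make the middle range empty. *)
  move=> _; exists (1 / 2), (1 / 2).
  split; first lra.
  split; first lra.
  split=> [d /andP[d0 d1]|].
    split; first exact: thr1.
    split; first by case/andP=> ? ?; lra.
    exact: threshold_zero_odd_even.
  split=> //; split=> //; split=> [_ l3'|//].
  by rewrite l3' in el.
move=> kl; have [l3'|l5] : l = 3%N \/ (5 <= l)%N.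
  have [/eqP l4|l4] := boolP (l == 4%N); first by rewrite l4 in ol.
  by clear -l3 l4; lia.
  have k3' : k = 3%N by clear -k3 kl l3'; lia.
  exists (1 / 2), (4 / 5).
  split; first lra.
  split; first lra.
  split=> [d /andP[d0 d1]|]; last by rewrite l3'.
  split; first exact: thr1.
  split=> [/andP[d2 d3]|d2]; last by rewrite k3' l3'; apply: threshold_zero_triangles.
  (* Five parts give the density 4/5; below, four parts give 3/4. *)
  apply: (thr2 5%N) => //; first by lra.
  by move=> n; rewrite k3' l3'; apply: not_ramsey_5partite.
exists (1 / 2), (3 / 4).
split; first lra.
split; first lra.
split=> [d /andP[d0 d1]|].
  split; first exact: thr1.
  split=> [/andP[d2 d3]|d2]; last exact: threshold_zero_odd_odd.
  apply: (thr2 4%N) => //; first by lra.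
  by move=> n; apply: not_ramsey_4partite.
split=> //; split=> //; split=> // _ l3'.
by rewrite l3' in l5.
Qed.
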